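(* Given $0<\kappa<4$, set $\theta=-\sin^{-1}(\kappa/4)$, $\beta=2ie^{i\theta}$, $$k(z)=\frac{(z-\beta)(z-\overline\beta)^{e^{2i\theta}}}{(\kappa-\beta)(\kappa-\overline\beta)^{e^{2i\theta}}},\qquad g_t(z)=(1-t)^{1/2}\,k^{-1}\bigl((1-t)^{-\cos\theta\, e^{i\theta}}k(z)\bigr),\quad 0\le t<1 .$$ Then $k$ is a conformal map of $\mathbb H$ onto $\mathbb C\setminus S^1$, where $S^1=\{e^{te^{i\theta}}:t\ge0\}$ is a logarithmic spiral in $\mathbb C$ beginning at $1$ and tending to $\infty$, and $g_t$ satisfies the Loewner equation $$\dot g_t=\frac{2}{g_t-\kappa\sqrt{1-t}},\qquad g_0(z)\equiv z .$$ The trace $\gamma=k^{-1}\bigl(\{e^{-te^{i\theta}}:t>0\}\bigr)$ is a curve in $\mathbb H$ beginning at $\kappa\in\mathbb R$ and spiraling around $\beta\in\mathbb H$. The case $-4<\kappa<0$ is obtained from the case $0<\kappa<4$ by reflecting about the imaginary axis.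
   Context: $\mathbb H$ is the upper half-plane. The power $(z-\overline\beta)^{e^{2i\theta}}=\exp\bigl(e^{2i\theta}\log(z-\overline\beta)\bigr)$ uses a single continuous branch of $\log(z-\overline\beta)$ on $\overline{\mathbb H}$ (note $\overline\beta$ lies in the lower half-plane). For $0\le t<1$, $(1-t)^{-\cos\theta e^{i\theta}}=\exp(-\cos\theta\,e^{i\theta}\log(1-t))$. The map $g_t$ is defined on $\mathbb H\setminus\gamma((0,t])$, where $\gamma$ is parametrized by half-plane capacity (the hydrodynamically normalized map $g_t$ of $\mathbb H\setminus\gamma((0,t])$ onto $\mathbb H$ satisfies $g_t(z)=z+2t/z+O(1/z^2)$ at $\infty$), and the dot denotes $\partial/\partial t$. The trace $\gamma$ is the curve generating the hulls of the Loewner equation with driving term $\lambda(t)=\kappa\sqrt{1-t}$. Reflection about the imaginary axis is $z\mapsto-\overline z$; it conjugates solutions with driving term $\lambda$ to those with driving term $-\lambda$. *)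

(* Defs.v *)
From Stdlib Require Import Reals Lra ClassicalEpsilon.
From Coquelicot Require Import Coquelicot.
Open Scope R_scope.

(** * Complex exponential and logarithm *)

Definition Cexp (z : C) : C := (exp (Re z) * cos (Im z), exp (Re z) * sin (Im z)).

(* On {Im z > 0} the principal argument is PI/2 - atan (Re z / Im z); the value
   outside the upper half-plane is irrelevant. *)
Definition Clog (z : C) : C := (ln (Cmod z), PI / 2 - atan (Re z / Im z)).

Lemma Cexp_Clog (z : C) : 0 < Im z -> Cexp (Clog z) = z.
Proof.
destruct z as [x y]; unfold Cexp, Clog, Cmod, Re, Im; cbn [fst snd].
intros Hy.
assert (Hm : 0 < x ^ 2 + y ^ 2) by nra.
rewrite exp_ln by (apply sqrt_lt_R0; exact Hm).
rewrite cos_shift, sin_shift, sin_atan, cos_atan.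
replace (1 + (x / y)²) with ((x ^ 2 + y ^ 2) / y ^ 2)
  by (unfold Rsqr; field; lra).
rewrite sqrt_div_alt by nra.
rewrite (sqrt_pow2 y) by lra.
assert (Hs := sqrt_lt_R0 _ Hm).
f_equal; field; split; lra.
Qed.

Definition Cpower (w a : C) : C := Cexp (a * Clog w).

Definition Rpower_C (x : R) (a : C) : C := Cexp (a * ln x).

(** * Half-plane, conformal maps, reflection *)

Definition UH (z : C) : Prop := 0 < Im z.

Definition conformal_onto (A B : C -> Prop) (f : C -> C) : Prop :=
  (forall z, A z -> ex_derive (K := C_AbsRing) (V := C_NormedModule) f z) /\
  (forall z, A z -> B (f z)) /\
  (forall z w, A z -> A w -> f z = f w -> z = w) /\
  (forall w, B w -> exists z, A z /\ f z = w).

Definition refl (z : C) : C := Copp (Cconj z).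

(** * Loewner evolution *)

(* Derivative relative to a set D of times: one-sided at an end point of D. *)
Definition is_derive_on (D : R -> Prop) (u : R -> C) (t : R) (l : C) : Prop :=
  filterdiff (K := R_AbsRing) (U := R_NormedModule) (V := C_R_NormedModule)
    u (within D (locally t)) (fun h => scal h l).

Definition loewner_solution (lam : R -> R) (z : C) (t : R) (u : R -> C) : Prop :=
  u 0 = z /\
  forall s, 0 <= s <= t ->
    u s <> RtoC (lam s) /\
    is_derive_on (fun r => 0 <= r <= t) u s (2 / (u s - lam s))%C.

(* The points of the half-plane whose trajectory does not survive up to and
   including time t. *)
Definition loewner_hull (lam : R -> R) (t : R) (z : C) : Prop :=
  UH z /\ ~ exists u, loewner_solution lam z t u.

Definition arc_upto (gamma : R -> C) (t : R) (z : C) : Prop :=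
  exists s, 0 < s <= t /\ gamma s = z.

(* The curve gamma, defined on (0, T), generates the hulls driven by lam; the
   parameter of gamma is the Loewner time. *)
Definition loewner_trace (lam : R -> R) (T : R) (gamma : R -> C) : Prop :=
  continuous_on (U := C_UniformSpace) (fun t => 0 < t < T) gamma /\
  forall t, 0 <= t < T ->
    forall z, loewner_hull lam t z <-> arc_upto gamma t z.

Definition slit (gamma : R -> C) (t : R) (z : C) : Prop :=
  UH z /\ ~ arc_upto gamma t z.

(* f(z) = z + 2t/z + O(1/z^2) at infinity in A: hydrodynamic normalization with
   half-plane capacity 2t. *)
Definition hydrodynamic (A : C -> Prop) (t : R) (f : C -> C) : Prop :=
  exists M r : R, 0 < r /\
    forall z, A z -> r < Cmod z ->
      Cmod (f z - (z + RtoC (2 * t) / z)) <= M / Cmod z ^ 2.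

(** * Spirals *)

(* In polar coordinates, rho = a * exp (b * phi) with b <> 0, traced
   continuously and injectively for t >= 0. *)
Definition log_spiral (c : R -> C) : Prop :=
  exists (a b : R) (phi : R -> R),
    0 < a /\ b <> 0 /\
    continuous_on (fun t => 0 <= t) phi /\
    (forall s t, 0 <= s -> 0 <= t -> phi s = phi t -> s = t) /\
    (forall t, 0 <= t -> c t = (RtoC (a * exp (b * phi t)) * Cexp (Ci * phi t))%C).

(* As t -> T, gamma(t) tends to b while its argument about b is unbounded in one
   direction: infinitely many turns. *)
Definition spirals_around (gamma : R -> C) (T : R) (b : C) : Prop :=
  filterlim gamma (at_left T) (locally (T := C_UniformSpace) b) /\
  exists phi : R -> R,
    continuous_on (fun t => 0 < t < T) phi /\
    (forall t, 0 < t < T ->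
       gamma t <> b /\
       (gamma t - b)%C = (RtoC (Cmod (gamma t - b)) * Cexp (Ci * phi t))%C) /\
    (filterlim phi (at_left T) (Rbar_locally p_infty) \/
     filterlim phi (at_left T) (Rbar_locally m_infty)).

(** * The explicit maps *)

Definition lambda (kappa t : R) : R := kappa * sqrt (1 - t).

Definition theta (kappa : R) : R := - asin (kappa / 4).

Definition eith (kappa : R) : C := Cexp (Ci * theta kappa).

Definition beta (kappa : R) : C := (2 * Ci * eith kappa)%C.

Definition k_num (kappa : R) (z : C) : C :=
  ((z - beta kappa) *
   Cpower (z - Cconj (beta kappa)) (Cexp (2 * Ci * theta kappa)))%C.

Definition k (kappa : R) (z : C) : C := (k_num kappa z / k_num kappa kappa)%C.

(* Inverse of the restriction of k to the upper half-plane. *)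
Definition k_inv (kappa : R) (w : C) : C :=
  epsilon (inhabits (RtoC 0)) (fun z => UH z /\ k kappa z = w).

Definition k_scaled (kappa t : R) (z : C) : C :=
  (Rpower_C (1 - t) (- (RtoC (cos (theta kappa)) * eith kappa)) * k kappa z)%C.

Definition g (kappa t : R) (z : C) : C :=
  (RtoC (sqrt (1 - t)) * k_inv kappa (k_scaled kappa t z))%C.

Definition spiral (kappa t : R) : C := Cexp (RtoC t * eith kappa).

Definition S1 (kappa : R) (w : C) : Prop := exists t, 0 <= t /\ w = spiral kappa t.

(* Main.v *)
Require Import Defs.
From Stdlib Require Import Reals Lra Psatz ClassicalEpsilon Classical FunctionalExtensionality.
From Coquelicot Require Import Coquelicot.
Open Scope R_scope.

(** Write [e = eith kappa] and [c = cos (theta kappa) > 0].  Everything rests on the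
    logarithmic derivative [k' / k = 2 c e (z - kappa) / (z^2 - kappa z + 4)]
    ([cdiff_k], [k_div_dk]); the argument is the same for both signs of [kappa].
    The rescaled Loewner flow
    [W = u / sqrt (1 - t)] satisfies [2 (1 - t) W' = (W^2 - kappa W + 4) / (W - kappa)],
    so [log (k W) / e] moves at the speed [c / (1 - t)]: the flow multiplies [k] by
    [(1 - t)^(- c e)].  This gives both the equation for [g] ([cdiff_g]) and a
    conservation law for every solution ([loewner_conserved]).

    That [k] is conformal onto the complement of the spiral is shown as follows.
    In the variable [s = log ((z - beta) / (z - conj beta))], which ranges over the left
    half-plane, [log k / e] has derivative [c (1 + exp s) / (1 - exp s) - i sin theta], of
    positive real part; by the Noshiro--Warschawski argument it is injective, also
    against boundary points, and it commutes with the period [2 i pi] up to the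
    ambiguity of the logarithm ([spiral_log_injective], [k_injective]).  On the real line
    [k] is [exp (height x * e)] with [height] vanishing at [kappa] only, positive
    elsewhere and unbounded, so the real line is mapped onto the spiral ([spiral_real],
    [k_real_S1]).  Together with [k -> oo] at infinity ([k_growth]) and the open mapping
    property, which is proved by minimizing [|k - w|], a continuity argument along the
    spiral from [w] to [0 = k beta] gives surjectivity ([k_surjective]), and the inverse
    is continuous, even at the boundary point [kappa] ([k_near]).

    By the conservation law a trajectory dies exactly when [k] along it reaches
    [1 = k kappa], so the hull at time [t] consists of the points [tip s] with
    [k (tip s) = (1 - s)^(c e)] and [s <= t] ([loewner_hull_iff]).  This describes every
    curve generating the hulls ([loewner_trace_tip]); its limits at both ends and its
    winding around [beta] are read off from [k].  The normalization of [g] at infinity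
    comes from integrating the Loewner equation, and the reflection from
    [k (- kappa) (- conj z) = conj (k kappa z)]. *)

(** * Complex calculus relative to a set *)

Definition ccont (A : C -> Prop) (f : C -> C) (z : C) : Prop :=
  forall eps, 0 < eps -> exists del, 0 < del /\
    forall w, A w -> Cmod (w - z) < del -> Cmod (f w - f z) < eps.

(** Caratheodory's form of differentiability: the quotient factor is continuous.
    The rules of calculus become identities between quotient factors, and relativity
    to [A] makes complex, real and one-sided derivatives instances of one notion. *)
Definition cdiff (A : C -> Prop) (f : C -> C) (z l : C) : Prop :=
  exists phi, (forall w, A w -> (f w - f z = phi w * (w - z))%C) /\
    phi z = l /\ ccont A phi z.

Definition total (z : C) : Prop := True.

Lemma Cmod_sub_sym (a b : C) : Cmod (a - b) = Cmod (b - a).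
Proof. rewrite <- Cmod_opp. f_equal. ring. Qed.

Lemma Cmod_sub_le (a b : C) : Cmod a - Cmod b <= Cmod (a - b).
Proof.
  assert (H := Cmod_triangle (a - b) b).
  replace (a - b + b)%C with a in H by ring. lra.
Qed.

Lemma Cmod_sub_triangle (a b c : C) : Cmod (a - c) <= Cmod (a - b) + Cmod (b - c).
Proof.
  replace (a - c)%C with ((a - b) + (b - c))%C by ring. apply Cmod_triangle.
Qed.

Lemma Im_le_Cmod (z : C) : Rabs (Im z) <= Cmod z.
Proof.
  assert (H := Rmax_Cmod z). assert (H' := Rmax_r (Rabs (fst z)) (Rabs (snd z))).
  unfold Im. lra.
Qed.

Lemma Cmod_le_Re_Im (z : C) : Cmod z <= Rabs (Re z) + Rabs (Im z).
Proof.
  destruct z as [x y]. unfold Cmod, Re, Im; simpl fst; simpl snd.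
  rewrite <- (sqrt_Rsqr (Rabs x + Rabs y)).
  2: assert (H1 := Rabs_pos x); assert (H2 := Rabs_pos y); lra.
  apply sqrt_le_1_alt. rewrite <- (pow2_abs x), <- (pow2_abs y).
  unfold Rsqr. assert (H1 := Rabs_pos x); assert (H2 := Rabs_pos y). nra.
Qed.

Lemma ccont_const A c z : ccont A (fun _ => c) z.
Proof.
  intros eps He. exists 1. split; [lra|]. intros w _ _.
  replace (c - c)%C with (RtoC 0) by ring. rewrite Cmod_0. exact He.
Qed.

Lemma ccont_id A z : ccont A (fun w => w) z.
Proof. intros eps He. exists eps. auto. Qed.

Lemma ccont_plus A f h z :
  ccont A f z -> ccont A h z -> ccont A (fun w => f w + h w)%C z.
Proof.
  intros Hf Hh eps He.
  destruct (Hf (eps / 2)) as [d1 [Hd1 H1]]; [lra|].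
  destruct (Hh (eps / 2)) as [d2 [Hd2 H2]]; [lra|].
  exists (Rmin d1 d2). split; [now apply Rmin_pos|].
  intros w Hw Hd.
  specialize (H1 w Hw (Rlt_le_trans _ _ _ Hd (Rmin_l _ _))).
  specialize (H2 w Hw (Rlt_le_trans _ _ _ Hd (Rmin_r _ _))).
  replace (f w + h w - (f z + h z))%C with ((f w - f z) + (h w - h z))%C by ring.
  assert (H := Cmod_triangle (f w - f z) (h w - h z)). lra.
Qed.

Lemma ccont_mult A f h z :
  ccont A f z -> ccont A h z -> ccont A (fun w => f w * h w)%C z.
Proof.
  intros Hf Hh eps He.
  set (F := Cmod (f z)). set (G := Cmod (h z)).
  assert (HF : 0 <= F) by apply Cmod_ge_0.
  assert (HG : 0 <= G) by apply Cmod_ge_0.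
  destruct (Hf (eps / (2 * (G + 1)))) as [d1 [Hd1 H1]].
  { apply Rdiv_lt_0_compat; lra. }
  destruct (Hh (Rmin 1 (eps / (2 * (F + 1))))) as [d2 [Hd2 H2]].
  { apply Rmin_pos; [lra|]. apply Rdiv_lt_0_compat; lra. }
  exists (Rmin d1 d2). split; [now apply Rmin_pos|].
  intros w Hw Hd.
  specialize (H1 w Hw (Rlt_le_trans _ _ _ Hd (Rmin_l _ _))).
  specialize (H2 w Hw (Rlt_le_trans _ _ _ Hd (Rmin_r _ _))).
  assert (H3 := Rlt_le_trans _ _ _ H2 (Rmin_l _ _)).
  assert (H4 := Rlt_le_trans _ _ _ H2 (Rmin_r _ _)).
  assert (H5 : Cmod (h w) < G + 1).
  { assert (H := Cmod_sub_le (h w) (h z)). unfold G. lra. }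
  replace (f w * h w - f z * h z)%C
    with ((f w - f z) * h w + f z * (h w - h z))%C by ring.
  assert (H := Cmod_triangle ((f w - f z) * h w) (f z * (h w - h z))).
  rewrite !Cmod_mult in H. fold F in H.
  assert (H6 : Cmod (f w - f z) * Cmod (h w) <= eps / 2).
  { replace (eps / 2) with (eps / (2 * (G + 1)) * (G + 1)) by (field; lra).
    apply Rmult_le_compat; try apply Cmod_ge_0; lra. }
  assert (H7 : F * Cmod (h w - h z) < eps / 2).
  { replace (eps / 2) with ((F + 1) * (eps / (2 * (F + 1)))) by (field; lra).
    assert (H8 := Cmod_ge_0 (h w - h z)).
    assert (0 < eps / (2 * (F + 1))) by (apply Rdiv_lt_0_compat; lra). nra. }
  lra.
Qed.

Lemma ccont_inv A f z : ccont A f z -> f z <> 0 -> ccont A (fun w => / f w)%C z.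
Proof.
  intros Hf Hz eps He.
  assert (HF : 0 < Cmod (f z)) by (now apply Cmod_gt_0).
  set (F := Cmod (f z)) in *.
  destruct (Hf (Rmin (F / 2) (eps * F * F / 2))) as [d [Hd H]].
  { apply Rmin_pos; [lra|]. apply Rdiv_lt_0_compat; [|lra].
    repeat apply Rmult_lt_0_compat; assumption. }
  exists d. split; [exact Hd|]. intros w Hw Hwd.
  specialize (H w Hw Hwd).
  assert (H1 := Rlt_le_trans _ _ _ H (Rmin_l _ _)).
  assert (H2 := Rlt_le_trans _ _ _ H (Rmin_r _ _)).
  assert (H3 : F / 2 < Cmod (f w)).
  { assert (H4 := Cmod_sub_le (f z) (f w)). rewrite Cmod_sub_sym in H4.
    fold F in H4. lra. }
  assert (Hw0 : f w <> 0) by (apply Cmod_gt_0; lra).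
  replace (/ f w - / f z)%C with ((f z - f w) / (f w * f z))%C by (field; auto).
  rewrite Cmod_div by (now apply Cmult_neq_0). rewrite Cmod_mult. fold F.
  rewrite Cmod_sub_sym.
  apply Rlt_div_l; [apply Rmult_lt_0_compat; lra|].
  assert (H4 : 0 < eps * F * (Cmod (f w) - F / 2)).
  { repeat apply Rmult_lt_0_compat; lra. }
  lra.
Qed.

Lemma ccont_comp A B f h z :
  ccont A f z -> ccont B h (f z) -> (forall w, A w -> B (f w)) ->
  ccont A (fun w => h (f w)) z.
Proof.
  intros Hf Hh HAB eps He.
  destruct (Hh eps He) as [d1 [Hd1 H1]]. destruct (Hf d1 Hd1) as [d [Hd H]].
  exists d. split; [exact Hd|]. intros w Hw Hwd. apply H1; auto.
Qed.

Lemma ccont_subset (A B : C -> Prop) f z :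
  (forall w, A w -> B w) -> ccont B f z -> ccont A f z.
Proof.
  intros HAB H eps He. destruct (H eps He) as [d [Hd H1]]. exists d. auto.
Qed.

Lemma ccont_ext (A : C -> Prop) f h z :
  A z -> (forall w, A w -> f w = h w) -> ccont A f z -> ccont A h z.
Proof.
  intros Hz E H eps He. destruct (H eps He) as [d [Hd H1]]. exists d.
  split; [exact Hd|]. intros w Hw Hwd. rewrite <- !E by assumption. auto.
Qed.

Lemma cdiff_ccont A f z l : cdiff A f z l -> ccont A f z.
Proof.
  intros [phi [E [_ Hc]]].
  assert (H : ccont A (fun w => f z + phi w * (w + - z))%C z).
  { repeat (apply ccont_plus || apply ccont_mult || apply ccont_const
      || apply ccont_id || assumption). }
  intros eps He. destruct (H eps He) as [d [Hd H1]]. exists d.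
  split; [exact Hd|]. intros w Hw Hwd. specialize (H1 w Hw Hwd).
  rewrite E by exact Hw.
  replace (phi w * (w - z))%C
    with (f z + phi w * (w + - z) - (f z + phi z * (z + - z)))%C by ring.
  exact H1.
Qed.

Lemma cdiff_const A c z : cdiff A (fun _ => c) z 0.
Proof.
  exists (fun _ => RtoC 0). split; [|split; [reflexivity|apply ccont_const]].
  intros; ring.
Qed.

Lemma cdiff_id A z : cdiff A (fun w => w) z 1.
Proof.
  exists (fun _ => RtoC 1). split; [|split; [reflexivity|apply ccont_const]].
  intros; ring.
Qed.

Lemma cdiff_eq A f z l l' : cdiff A f z l -> l = l' -> cdiff A f z l'.
Proof. intros H <-. exact H. Qed.

Lemma cdiff_plus A f h z lf lh :
  cdiff A f z lf -> cdiff A h z lh -> cdiff A (fun w => f w + h w)%C z (lf + lh)%C.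
Proof.
  intros [p [E1 [V1 C1]]] [q [E2 [V2 C2]]].
  exists (fun w => p w + q w)%C. split; [|split].
  - intros w Hw.
    replace (f w + h w - (f z + h z))%C with ((f w - f z) + (h w - h z))%C by ring.
    rewrite E1, E2 by assumption. ring.
  - now rewrite V1, V2.
  - now apply ccont_plus.
Qed.

Lemma cdiff_mult A f h z lf lh :
  cdiff A f z lf -> cdiff A h z lh ->
  cdiff A (fun w => f w * h w)%C z (lf * h z + f z * lh)%C.
Proof.
  intros Hf Hh. assert (Hc := cdiff_ccont _ _ _ _ Hh).
  destruct Hf as [p [E1 [V1 C1]]], Hh as [q [E2 [V2 C2]]].
  exists (fun w => p w * h w + f z * q w)%C. split; [|split].
  - intros w Hw.
    replace (f w * h w - (f z * h z))%C
      with ((f w - f z) * h w + f z * (h w - h z))%C by ring.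
    rewrite E1, E2 by assumption. ring.
  - now rewrite V1, V2.
  - apply ccont_plus; apply ccont_mult; auto using ccont_const.
Qed.

Lemma cdiff_scal A c f z l :
  cdiff A f z l -> cdiff A (fun w => c * f w)%C z (c * l)%C.
Proof.
  intros H. apply (cdiff_eq _ _ _ (0 * f z + c * l)%C).
  - exact (cdiff_mult A (fun _ => c) f z _ _ (cdiff_const A c z) H).
  - 
  ring.
Qed.

Lemma cdiff_inv A f z l :
  cdiff A f z l -> f z <> 0 -> (forall w, A w -> f w <> 0) ->
  cdiff A (fun w => / f w)%C z (- l / (f z * f z))%C.
Proof.
  intros Hf Hz HA. assert (Hc := cdiff_ccont _ _ _ _ Hf).
  destruct Hf as [p [E [V Cp]]].
  exists (fun w => - (1) * p w * (/ f z * / f w))%C. split; [|split].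
  - intros w Hw. specialize (HA w Hw).
    replace (/ f w - / f z)%C with (- (f w - f z) / (f z * f w))%C by (field; auto).
    rewrite E by assumption. field; auto.
  - rewrite V. field; auto.
  - repeat apply ccont_mult; auto using ccont_const, ccont_inv.
Qed.

Lemma cdiff_comp A B f h z lf lh :
  cdiff A f z lf -> cdiff B h (f z) lh -> (forall w, A w -> B (f w)) ->
  cdiff A (fun w => h (f w)) z (lh * lf)%C.
Proof.
  intros Hf Hh HAB. assert (Hc := cdiff_ccont _ _ _ _ Hf).
  destruct Hf as [p [E1 [V1 C1]]], Hh as [q [E2 [V2 C2]]].
  exists (fun w => q (f w) * p w)%C. split; [|split].
  - intros w Hw. rewrite E2 by auto. rewrite E1 by auto. ring.
  - now rewrite V1, V2.
  - apply ccont_mult; [|exact C1]. now apply (ccont_comp A B).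
Qed.

(** The quotient factor of [f] is nowhere zero on the range of a right inverse:
    at a zero [h w] it would force [w = w0], where its value is [l]. *)
Lemma cdiff_inverse A B f h w0 l :
  (forall w, B w -> A (h w)) -> (forall w, B w -> f (h w) = w) ->
  f (h w0) = w0 -> ccont B h w0 -> cdiff A f (h w0) l -> l <> 0 ->
  cdiff B h w0 (/ l)%C.
Proof.
  intros HBA Hfh Hw0 Hc [p [E [V Cp]]] Hl.
  assert (Hcp : ccont B (fun w => p (h w)) w0) by (now apply (ccont_comp B A)).
  exists (fun w => / p (h w))%C. split; [|split].
  - intros w Hw. assert (H := E (h w) (HBA w Hw)).
    rewrite Hw0, Hfh in H by exact Hw. rewrite H.
    assert (Hp : p (h w) <> 0).
    { intros H0. rewrite H0 in H.
      replace (0 * (h w - h w0))%C with (RtoC 0) in H by ring.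
      apply Hl. rewrite <- V. rewrite <- H0. f_equal. f_equal.
      symmetry. now apply Ceq_minus. }
    field; exact Hp.
  - now rewrite V.
  - apply ccont_inv; [exact Hcp|]. now rewrite V.
Qed.

Lemma cdiff_subset (A B : C -> Prop) f z l :
  (forall w, A w -> B w) -> cdiff B f z l -> cdiff A f z l.
Proof.
  intros HAB [p [E [V Cp]]]. exists p. split; [|split]; auto.
  now apply (ccont_subset A B).
Qed.

Lemma cdiff_ext (A : C -> Prop) f h z l :
  A z -> (forall w, A w -> f w = h w) -> cdiff A f z l -> cdiff A h z l.
Proof.
  intros Hz E [p [E1 H]]. exists p. split; [|exact H].
  intros w Hw. rewrite <- !E by assumption. auto.
Qed.

Lemma cdiff_eps A f z l : cdiff A f z l ->
  forall eps, 0 < eps -> exists del, 0 < del /\ forall w, A w ->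
    Cmod (w - z) < del -> Cmod (f w - f z - l * (w - z)) <= eps * Cmod (w - z).
Proof.
  intros [p [E [V Cp]]] eps He. destruct (Cp eps He) as [d [Hd H]].
  exists d. split; [exact Hd|]. intros w Hw Hwd.
  rewrite E by exact Hw. rewrite <- V.
  replace (p w * (w - z) - p z * (w - z))%C with ((p w - p z) * (w - z))%C by ring.
  rewrite Cmod_mult. apply Rmult_le_compat_r; [apply Cmod_ge_0|].
  apply Rlt_le, H; assumption.
Qed.

Lemma eps_cdiff (A : C -> Prop) f z l :
  (forall eps, 0 < eps -> exists del, 0 < del /\ forall w, A w ->
    Cmod (w - z) < del -> Cmod (f w - f z - l * (w - z)) <= eps * Cmod (w - z)) ->
  cdiff A f z l.
Proof.
  intros H.
  set (p := fun w => if excluded_middle_informative (w = z) then l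
                     else ((f w - f z) / (w - z))%C).
  assert (Hz : p z = l).
  { unfold p. destruct (excluded_middle_informative (z = z)); congruence. }
  exists p. split; [|split]; [|exact Hz|].
  - intros w Hw. unfold p. destruct (excluded_middle_informative (w = z)) as [->|Hne].
    + ring.
    + field. now apply Cminus_eq_contra.
  - intros eps He. destruct (H (eps / 2)) as [d [Hd H1]]; [lra|].
    exists d. split; [exact Hd|]. intros w Hw Hwd. rewrite Hz. unfold p.
    destruct (excluded_middle_informative (w = z)) as [->|Hne].
    + replace (l - l)%C with (RtoC 0) by ring. rewrite Cmod_0. exact He.
    + specialize (H1 w Hw Hwd).
      assert (Hn : (w - z)%C <> 0) by (now apply Cminus_eq_contra).
      replace ((f w - f z) / (w - z) - l)%C
        with ((f w - f z - l * (w - z)) / (w - z))%C by (field; exact Hn).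
      rewrite Cmod_div by exact Hn. apply Cmod_gt_0 in Hn.
      apply Rlt_div_l; [exact Hn|]. nra.
Qed.

Lemma cdiff_local (A B : C -> Prop) f z l r : 0 < r ->
  (forall w, B w -> Cmod (w - z) < r -> A w) -> cdiff A f z l -> cdiff B f z l.
Proof.
  intros Hr HAB H. apply eps_cdiff. intros eps He.
  destruct (cdiff_eps _ _ _ _ H eps He) as [d [Hd H1]].
  exists (Rmin d r). split; [now apply Rmin_pos|]. intros w Hw Hwd.
  assert (H2 := Rlt_le_trans _ _ _ Hwd (Rmin_l _ _)).
  assert (H3 := Rlt_le_trans _ _ _ Hwd (Rmin_r _ _)). auto.
Qed.

Lemma cdiff_is_derive f z l : cdiff total f z l ->
  is_derive (K := C_AbsRing) (V := C_NormedModule) f z l.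
Proof.
  intros H. split; [apply is_linear_scal_l|].
  intros x Hx. apply (is_filter_lim_locally_unique (V := AbsRing_NormedModule C_AbsRing)) in Hx. subst x.
  intros eps. destruct (cdiff_eps _ _ _ _ H eps (cond_pos eps)) as [d [Hd H1]].
  exists (mkposreal d Hd). intros w Hw.
  specialize (H1 w I Hw).
  change (Cmod (minus (minus (f w) (f z)) (scal (minus w z) l)) <= eps * Cmod (w - z)).
  replace (minus (minus (f w) (f z)) (scal (minus w z) l))
    with (f w - f z - l * (w - z))%C; [exact H1|].
  change (f w - f z - l * (w - z) = f w - f z - (w - z) * l)%C. ring.
Qed.

(** ** Curves *)

(** Curves are functions of the real part restricted to a set of real numbers,
    so that the rules above serve for real and complex derivatives alike. *)
Definition reals (D : R -> Prop) (w : C) : Prop := Im w = 0 /\ D (Re w).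

Definition curve (u : R -> C) (w : C) : C := u (Re w).

Lemma reals_eq D w : reals D w -> w = RtoC (Re w).
Proof. intros [H _]. destruct w as [x y]. unfold Im, Re, RtoC in *. simpl in *. now subst. Qed.

Lemma Cmod_RtoC_sub (s t : R) : Cmod (RtoC s - RtoC t) = Rabs (s - t).
Proof. rewrite <- RtoC_minus. apply Cmod_R. Qed.

Lemma cdiff_curve_iff D u t l : D t -> cdiff (reals D) (curve u) t l <->
  forall eps, 0 < eps -> exists del, 0 < del /\ forall s, D s -> Rabs (s - t) < del ->
    Cmod (u s - u t - RtoC (s - t) * l) <= eps * Rabs (s - t).
Proof.
  intros Ht. split.
  - intros H eps He. destruct (cdiff_eps _ _ _ _ H eps He) as [d [Hd H1]].
    exists d. split; [exact Hd|]. intros s Hs Hst.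
    specialize (H1 (RtoC s)). rewrite Cmod_RtoC_sub in H1.
    unfold curve in H1. rewrite !re_RtoC in H1.
    rewrite RtoC_minus. rewrite (Cmult_comm _ l). apply H1; [|exact Hst].
    split; [apply im_RtoC|]. now rewrite re_RtoC.
  - intros H. apply eps_cdiff. intros eps He. destruct (H eps He) as [d [Hd H1]].
    exists d. split; [exact Hd|]. intros w Hw. rewrite (reals_eq _ _ Hw).
    destruct Hw as [_ Hw]. rewrite Cmod_RtoC_sub. intros Hd'.
    unfold curve. rewrite !re_RtoC. rewrite <- RtoC_minus.
    rewrite (Cmult_comm l). apply H1; assumption.
Qed.

Lemma cdiff_is_derive_on D u t l : D t ->
  cdiff (reals D) (curve u) t l <-> is_derive_on D u t l.
Proof.
  intros Ht. rewrite cdiff_curve_iff by exact Ht. split.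
  - intros H. split; [exact (is_linear_scal_l (K := R_AbsRing) (V := C_R_NormedModule) l)|].
    intros x Hx.
    assert (Hp : ProperFilter' (within D (locally (T := R_UniformSpace) t))).
    { constructor; [|apply within_filter, locally_filter].
      intros [e He]. apply (He t); [apply ball_center|exact Ht]. }
    assert (x = t).
    { symmetry. apply (is_filter_lim_unique (V := R_NormedModule) t x); [|exact Hx].
      intros P HP. now apply filter_le_within. }
    subst x. intros eps.
    destruct (H eps (cond_pos eps)) as [d [Hd H1]].
    exists (mkposreal d Hd). intros s Hs Ds.
    specialize (H1 s Ds Hs). unfold minus, plus, opp in *; simpl in *.
    match goal with |- norm ?a <= _ => replace a with (u s - u t - RtoC (s - t) * l)%C end.
    + rewrite <- Cmod_norm. exact H1.
    + destruct (u s), (u t), l. unfold scal; simpl. unfold prod_scal, scal, mult; simpl.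
      unfold mult, Cminus, Cplus, Cmult, Copp, RtoC, Rminus, prod_plus, prod_opp, plus, opp; simpl.
      f_equal; ring.
  - intros [_ H] eps He.
    specialize (H t). destruct H with (eps := mkposreal eps He) as [d H1].
    { intros P HP. now apply filter_le_within. }
    exists d. split; [apply cond_pos|]. intros s Ds Hs.
    specialize (H1 s Hs Ds). unfold minus, plus, opp in *; simpl in *.
    match type of H1 with norm ?a <= _ => replace a with (u s - u t - RtoC (s - t) * l)%C in H1 end.
    + rewrite <- Cmod_norm in H1. exact H1.
    + destruct (u s), (u t), l. unfold scal; simpl. unfold prod_scal, scal, mult; simpl.
      unfold mult, Cminus, Cplus, Cmult, Copp, RtoC, Rminus, prod_plus, prod_opp, plus, opp; simpl.
      f_equal; ring.
Qed.

Lemma cdiff_real (D : R -> Prop) (f : R -> R) t l :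
  is_derive f t l -> cdiff (reals D) (fun w => RtoC (f (Re w))) t l.
Proof.
  intros [_ H]. apply eps_cdiff. intros eps He.
  destruct (H t) with (eps := mkposreal eps He) as [d H1].
  { intros P HP. exact HP. }
  exists d. split; [apply cond_pos|]. intros w Hw. rewrite (reals_eq _ _ Hw).
  rewrite Cmod_RtoC_sub, !re_RtoC. intros Hd. specialize (H1 (Re w) Hd).
  rewrite <- !RtoC_minus, <- RtoC_mult, <- RtoC_minus, Cmod_R.
  change (Rabs (f (Re w) - f t - (Re w - t) * l) <= eps * Rabs (Re w - t)) in H1.
  rewrite (Rmult_comm l). exact H1.
Qed.

(** Scalar products with a fixed [c] reduce curves to real functions, at the
    price of an intermediate point that depends on [c]. *)
Lemma curve_MVT (f : C -> C) (l : R -> C) a b (c : C) : a < b ->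
  (forall s, a <= s <= b -> cdiff (reals (fun r => a <= r <= b)) f s (l s)) ->
  exists xi, a < xi < b /\ Re (c * (f b - f a)) = (b - a) * Re (c * l xi).
Proof.
  intros Hab Hf.
  (* Clamping to [a, b] extends one-sided continuity at the ends to two-sided. *)
  set (cl := fun x => Rmax a (Rmin b x)).
  assert (Hcl : forall x, a <= cl x <= b).
  { intros x. unfold cl. split; [apply Rmax_l|]. apply Rmax_lub; [lra|apply Rmin_l]. }
  assert (Hid : forall x, a <= x <= b -> cl x = x).
  { intros x Hx. unfold cl. rewrite Rmin_right, Rmax_right; lra. }
  assert (Hlip : forall x y, Rabs (cl x - cl y) <= Rabs (x - y)).
  { intros x y. unfold cl, Rmax, Rmin.
    repeat destruct (Rle_dec _ _); unfold Rabs; repeat destruct (Rcase_abs _); lra. }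
  set (phi := fun x => Re (c * f (cl x))).
  assert (Hre : forall x y, Rabs (phi x - phi y) <= Cmod c * Cmod (f (cl x) - f (cl y))).
  { intros x y. rewrite <- Cmod_mult. unfold phi.
    replace (Re (c * f (cl x)) - Re (c * f (cl y)))
      with (Re (c * (f (cl x) - f (cl y)))).
    - apply re_le_Cmod.
    - unfold Re, Cmult, Cminus, Cplus, Copp; simpl; ring. }
  assert (Hin : forall x, reals (fun r => a <= r <= b) (RtoC (cl x))).
  { intros x. split; [apply im_RtoC|]. rewrite re_RtoC. apply Hcl. }
  assert (Hcont : forall x, continuity_pt phi x).
  { intros x eps He.
    destruct (cdiff_ccont _ _ _ _ (Hf (cl x) (Hcl x)) (eps / (Cmod c + 1)))
      as [d [Hd H]].
    { apply Rdiv_lt_0_compat; [lra|]. assert (H := Cmod_ge_0 c). lra. }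
    exists d. split; [exact Hd|]. intros y [_ Hy]. simpl in Hy |- *. unfold R_dist in *.
    specialize (H (RtoC (cl y)) (Hin y)). rewrite Cmod_RtoC_sub in H.
    specialize (H (Rle_lt_trans _ _ _ (Hlip y x) Hy)).
    apply Rle_lt_trans with (1 := Hre y x).
    assert (H1 := Cmod_ge_0 c).
    apply Rle_lt_trans with ((Cmod c) * (eps / (Cmod c + 1))).
    - apply Rmult_le_compat_l; lra.
    - apply Rlt_le_trans with ((Cmod c + 1) * (eps / (Cmod c + 1))).
      + apply Rmult_lt_compat_r; [|lra]. apply Rdiv_lt_0_compat; lra.
      + right. field. lra. }
  assert (Hder : forall x, a < x < b -> derivable_pt_lim phi x (Re (c * l x))).
  { intros x Hx eps He.
    destruct (cdiff_eps _ _ _ _ (Hf x (conj (Rlt_le _ _ (proj1 Hx)) (Rlt_le _ _ (proj2 Hx))))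
      (eps / (2 * (Cmod c + 1)))) as [d [Hd H]].
    { apply Rdiv_lt_0_compat; [lra|]. assert (H := Cmod_ge_0 c). lra. }
    assert (Hd' : 0 < Rmin d (Rmin (x - a) (b - x))).
    { repeat apply Rmin_pos; lra. }
    exists (mkposreal _ Hd'). intros h Hh0 Hh. simpl in Hh.
    assert (Hh1 := Rlt_le_trans _ _ _ Hh (Rmin_l _ _)).
    assert (Hh2 := Rlt_le_trans _ _ _ Hh (Rmin_r _ _)).
    assert (Hh3 := Rlt_le_trans _ _ _ Hh2 (Rmin_l _ _)).
    assert (Hh4 := Rlt_le_trans _ _ _ Hh2 (Rmin_r _ _)).
    assert (Hx' : a <= x + h <= b).
    { apply Rabs_def2 in Hh3. apply Rabs_def2 in Hh4. lra. }
    specialize (H (RtoC (x + h))).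
    assert (H1 : Cmod (f (x + h)%R - f x - l x * ((x + h)%R - x))
        <= eps / (2 * (Cmod c + 1)) * Cmod ((x + h)%R - x)).
    { apply H.
      - split; [apply im_RtoC|]. now rewrite re_RtoC.
      - rewrite Cmod_RtoC_sub. now replace (x + h - x) with h by ring. }
    replace (RtoC (x + h) - RtoC x)%C with (RtoC h) in H1
      by (rewrite RtoC_plus; ring).
    rewrite Cmod_R in H1.
    unfold phi. rewrite !Hid by lra.
    replace ((Re (c * f (x + h)%R) - Re (c * f x)) / h - Re (c * l x))
      with (Re (c * (f (x + h)%R - f x - l x * h)) / h).
    2:{ unfold Re, Cmult, Cminus, Cplus, Copp, RtoC; simpl. field. exact Hh0. }
    unfold Rdiv. rewrite Rabs_mult, Rabs_inv.
    apply Rabs_pos_lt in Hh0. apply Rlt_div_l; [exact Hh0|].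
    apply Rle_lt_trans with (1 := re_le_Cmod _). rewrite Cmod_mult.
    assert (H2 := Cmod_ge_0 c).
    apply Rle_lt_trans with (Cmod c * (eps / (2 * (Cmod c + 1)) * Rabs h)).
    - apply Rmult_le_compat_l; lra.
    - apply Rlt_le_trans with ((Cmod c + 1) * (eps / (2 * (Cmod c + 1)) * Rabs h)).
      + apply Rmult_lt_compat_r; [|lra]. apply Rmult_lt_0_compat; [|exact Hh0].
        apply Rdiv_lt_0_compat; lra.
      + replace ((Cmod c + 1) * (eps / (2 * (Cmod c + 1)) * Rabs h))
          with (eps / 2 * Rabs h) by (field; lra). nra. }
  destruct (MVT phi id a b (fun x Hx => exist _ _ (Hder x Hx))
    (fun x _ => derivable_pt_id x) Hab (fun x _ => Hcont x)
    (fun x _ => derivable_continuous_pt _ _ (derivable_pt_id x))) as [xi [Hxi E]].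
  exists xi. split; [exact Hxi|].
  rewrite derive_pt_id in E. unfold id in E.
  replace (derive_pt phi xi _) with (Re (c * l xi)) in E by reflexivity.
  rewrite E. unfold phi. rewrite !Hid by lra.
  unfold Re, Cmult, Cminus, Cplus, Copp; simpl; ring.
Qed.

Lemma Re_conj_mult (z : C) : Re (Cconj z * z) = Cmod z ^ 2.
Proof.
  rewrite Cmod2_alt. destruct z as [x y]. unfold Re, Im, Cconj, Cmult; simpl. ring.
Qed.

(** The intermediate point is taken in the direction of the increment itself. *)
Lemma curve_increment_le (f : C -> C) (l : R -> C) a b M : a <= b ->
  (forall s, a <= s <= b -> cdiff (reals (fun r => a <= r <= b)) f s (l s)) ->
  (forall s, a < s < b -> Cmod (l s) <= M) ->
  Cmod (f b - f a) <= M * (b - a).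
Proof.
  intros [Hab|<-] Hf Hl.
  2:{ replace (f a - f a)%C with (RtoC 0) by ring. rewrite Cmod_0. lra. }
  destruct (curve_MVT f l a b (Cconj (f b - f a)) Hab Hf) as [xi [Hxi E]].
  rewrite Re_conj_mult in E.
  assert (H1 := re_le_Cmod (Cconj (f b - f a) * l xi)).
  rewrite Cmod_mult, Cmod_conj in H1.
  assert (H2 := Rle_abs (Re (Cconj (f b - f a) * l xi))).
  set (X := Cmod (f b - f a)) in *. assert (HX : 0 <= X) by apply Cmod_ge_0.
  assert (H3 : Cmod (l xi) <= M) by (now apply Hl).
  assert (H4 : X * Cmod (l xi) <= X * M) by (now apply Rmult_le_compat_l).
  destruct HX as [HX|HX].
  - apply Rmult_le_reg_l with X; [exact HX|].
    replace (X * X) with (X ^ 2) by ring. rewrite E.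
    replace (X * (M * (b - a))) with ((b - a) * (X * M)) by ring.
    apply Rmult_le_compat_l; lra.
  - rewrite <- HX. apply Rmult_le_pos; [|lra].
    apply Rle_trans with (2 := H3). apply Cmod_ge_0.
Qed.

Lemma curve_constant (f : C -> C) a b : a <= b ->
  (forall s, a <= s <= b -> cdiff (reals (fun r => a <= r <= b)) f s 0) -> f b = f a.
Proof.
  intros Hab Hf. apply Ceq_minus, Cmod_eq_0.
  assert (H := curve_increment_le f (fun _ => RtoC 0) a b 0 Hab Hf).
  assert (H1 := Cmod_ge_0 (f b - f a)).
  assert (H2 : Cmod (f b - f a) <= 0 * (b - a)); [|lra].
  apply H. intros. rewrite Cmod_0. lra.
Qed.

(** At the infimum of the failures of [Q], the second hypothesis gives [Q], and the
    first one contradicts minimality. *)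
Lemma real_induction (Q : R -> Prop) T :
  (forall s, 0 <= s <= T -> Q s -> exists d, 0 < d /\
    forall r, 0 <= r <= T -> Rabs (r - s) < d -> Q r) ->
  (forall s, 0 <= s <= T -> (forall r, 0 <= r < s -> Q r) -> Q s) ->
  forall s, 0 <= s <= T -> Q s.
Proof.
  intros Hopen Hstep s Hs. destruct (classic (Q s)) as [H|Hn]; [exact H|exfalso].
  (* The infimum of the failures is the opposite of a supremum. *)
  destruct (completeness (fun x => 0 <= - x <= T /\ ~ Q (- x))) as [m [Hm1 Hm2]].
  { exists 0. intros x Hx. lra. }
  { exists (- s). rewrite Ropp_involutive. auto. }
  assert (H0 : 0 <= - m).
  { assert (m <= 0); [|lra]. apply Hm2. intros x Hx. lra. }
  assert (HT : - m <= T).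
  { assert (- s <= m); [|lra]. apply Hm1. rewrite Ropp_involutive. auto. }
  assert (HQ : Q (- m)).
  { apply Hstep; [lra|]. intros r Hr. destruct (classic (Q r)) as [H|H]; [exact H|].
    assert (- r <= m); [|lra]. apply Hm1. rewrite Ropp_involutive. split; [lra|exact H]. }
  destruct (Hopen (- m)) as [d [Hd H]]; [lra|exact HQ|].
  assert (m <= m - d); [|lra].
  apply Hm2. intros x [Hx HQx]. apply Rnot_lt_le. intros Hlt. apply HQx, H; [lra|].
  assert (x <= m) by (apply Hm1; auto). apply Rabs_def1; lra.
Qed.

(** * Exponential and logarithm *)

Lemma Cexp_plus a b : Cexp (a + b) = (Cexp a * Cexp b)%C.
Proof.
  destruct a as [x y], b as [u v].
  unfold Cexp, Cplus, Cmult, Re, Im; simpl. rewrite exp_plus, cos_plus, sin_plus.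
  f_equal; ring.
Qed.

Lemma Cexp_0 : Cexp 0 = 1.
Proof. unfold Cexp, RtoC, Re, Im; simpl. rewrite exp_0, cos_0, sin_0. f_equal; ring. Qed.

Lemma Cmod_Cexp a : Cmod (Cexp a) = exp (Re a).
Proof.
  unfold Cexp, Cmod; simpl.
  replace (_ + _) with ((exp (Re a)) ^ 2).
  - apply sqrt_pow2. left; apply exp_pos.
  - assert (H := sin2_cos2 (Im a)). unfold Rsqr in H. nra.
Qed.

Lemma Cexp_neq_0 a : Cexp a <> 0.
Proof. apply Cmod_gt_0. rewrite Cmod_Cexp. apply exp_pos. Qed.

Lemma Cexp_opp a : Cexp (- a) = (/ Cexp a)%C.
Proof.
  assert (H := Cexp_neq_0 a).
  assert (E : (Cexp (- a) * Cexp a = 1)%C).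
  { rewrite <- Cexp_plus. replace (- a + a)%C with (RtoC 0) by ring. apply Cexp_0. }
  apply (f_equal (fun x => x * / Cexp a)%C) in E.
  replace (Cexp (- a)) with (Cexp (- a) * Cexp a * / Cexp a)%C by (field; exact H).
  rewrite E. ring.
Qed.

Lemma Cexp_conj a : Cexp (Cconj a) = Cconj (Cexp a).
Proof.
  destruct a as [x y]. unfold Cexp, Cconj, Re, Im; simpl.
  rewrite cos_neg, sin_neg. f_equal; ring.
Qed.

Lemma Cexp_RtoC (x : R) : Cexp x = RtoC (exp x).
Proof. unfold Cexp, RtoC, Re, Im; simpl. rewrite cos_0, sin_0. f_equal; ring. Qed.

Lemma Cexp_polar a : Cexp a = (RtoC (Cmod (Cexp a)) * Cexp (Ci * RtoC (Im a)))%C.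
Proof.
  rewrite Cmod_Cexp, <- Cexp_RtoC, <- Cexp_plus. f_equal.
  destruct a as [x y]. unfold Re, Im, Ci, RtoC, Cmult, Cplus; simpl. f_equal; ring.
Qed.

Lemma Cexp_eq_1 a : Cexp a = 1 -> exists n : Z, a = (2 * Ci * RtoC (IZR n * PI))%C.
Proof.
  intros H.
  assert (H1 : Re a = 0).
  { apply exp_inv. rewrite <- Cmod_Cexp, H, Cmod_1. symmetry; apply exp_0. }
  assert (H2 : cos (Im a) = 1).
  { apply (f_equal fst) in H. unfold Cexp in H; simpl in H.
    rewrite H1, exp_0 in H. lra. }
  assert (H3 : sin (Im a / 2) = 0).
  { replace (Im a) with (2 * (Im a / 2)) in H2 by field.
    rewrite cos_2a_sin in H2. nra. }
  destruct (sin_eq_0_0 _ H3) as [n Hn]. exists n.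
  destruct a as [x y]. unfold Re, Im, Ci, RtoC, Cmult in *; simpl in *.
  f_equal; lra.
Qed.

Lemma Cexp_inj_mod a b : Cexp a = Cexp b ->
  exists n : Z, a = (b + 2 * Ci * RtoC (IZR n * PI))%C.
Proof.
  intros H. destruct (Cexp_eq_1 (a - b)) as [n Hn].
  - unfold Cminus. rewrite Cexp_plus, Cexp_opp, H. field. apply Cexp_neq_0.
  - exists n. rewrite <- Hn. ring.
Qed.

Lemma Cexp_2PI (n : Z) : Cexp (2 * Ci * RtoC (IZR n * PI)) = 1.
Proof.
  unfold Cexp, RtoC, Re, Im; simpl.
  match goal with |- (exp ?a * cos ?b, exp ?a * sin ?b) = _ =>
    replace a with 0 by ring; replace b with (2 * (IZR n * PI)) by ring end.
  assert (Hs : sin (IZR n * PI) = 0) by (apply sin_eq_0_1; now exists n).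
  rewrite exp_0, cos_2a_sin, sin_2a, Hs. f_equal; ring.
Qed.

(** Every non-zero number is, up to sign, positive or in the upper half-plane. *)
Lemma Cexp_surjective (z : C) : z <> 0 -> exists a, Cexp a = z.
Proof.
  intros Hz.
  assert (Hpos : forall w : C, 0 < Im w \/ (Im w = 0 /\ 0 < Re w) -> exists a, Cexp a = w).
  { intros w [H|[H1 H2]].
    - exists (Clog w). now apply Cexp_Clog.
    - exists (RtoC (ln (Re w))). rewrite Cexp_RtoC, exp_ln by exact H2.
      destruct w as [x y]. unfold Re, Im, RtoC in *; simpl in *. now subst. }
  assert (H : forall w : C, (exists a, Cexp a = (- w)%C) -> exists a, Cexp a = w).
  { intros w [a Ha]. exists (a + Ci * PI)%C. rewrite Cexp_plus, Ha.
    unfold Cexp, Ci, RtoC, Re, Im; simpl.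
    replace (0 * PI - 1 * 0) with 0 by ring. replace (0 * 0 + 1 * PI) with PI by ring.
    rewrite exp_0, cos_PI, sin_PI. destruct w. unfold Cmult, Copp; simpl. f_equal; ring. }
  destruct z as [x y].
  destruct (Rtotal_order y 0) as [Hy|[Hy|Hy]].
  - apply H, Hpos. left. unfold Im; simpl. lra.
  - subst y. destruct (Rtotal_order x 0) as [Hx|[Hx|Hx]].
    + apply H, Hpos. right. unfold Im, Re; simpl. lra.
    + subst. now elim Hz.
    + apply Hpos. right. unfold Im, Re; simpl. lra.
  - apply Hpos. left. exact Hy.
Qed.

Lemma derive_0_bound (f : R -> R) l : is_derive f 0 l ->
  forall eps, 0 < eps -> exists del, 0 < del /\ forall x, Rabs x < del ->
    Rabs (f x - f 0 - x * l) <= eps * Rabs x.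
Proof.
  intros [_ H] eps He. destruct (H 0) with (eps := mkposreal eps He) as [d H1].
  { intros P HP. exact HP. }
  exists d. split; [apply cond_pos|]. intros x Hx.
  specialize (H1 x). change (Rabs (x - 0) < d ->
    Rabs (f x - f 0 - (x - 0) * l) <= eps * Rabs (x - 0)) in H1.
  rewrite Rminus_0_r in H1. auto.
Qed.

Lemma cdiff_Cexp_0 : cdiff total Cexp 0 1.
Proof.
  apply eps_cdiff. intros eps He.
  set (e := Rmin (1 / 2) (eps / 10)).
  assert (He1 : 0 < e) by (apply Rmin_pos; lra).
  assert (He2 : e <= 1 / 2) by apply Rmin_l.
  assert (He3 : e <= eps / 10) by apply Rmin_r. clearbody e.
  destruct (derive_0_bound exp 1) with (eps := e) as [d1 [Hd1 H1]]; [|exact He1|].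
  { auto_derive; [easy|]. rewrite exp_0. ring. }
  destruct (derive_0_bound cos 0) with (eps := e) as [d2 [Hd2 H2]]; [|exact He1|].
  { auto_derive; [easy|]. rewrite sin_0. ring. }
  destruct (derive_0_bound sin 1) with (eps := e) as [d3 [Hd3 H3]]; [|exact He1|].
  { auto_derive; [easy|]. rewrite cos_0. ring. }
  exists (Rmin e (Rmin d1 (Rmin d2 d3))).
  split; [repeat apply Rmin_pos; assumption|].
  intros w _ Hw. replace (w - 0)%C with w in * by ring.
  assert (Ha := Rlt_le_trans _ _ _ Hw (Rmin_l _ _)).
  assert (Hb := Rlt_le_trans _ _ _ Hw (Rmin_r _ _)).
  assert (Hc := Rlt_le_trans _ _ _ Hb (Rmin_l _ _)).
  assert (Hd := Rlt_le_trans _ _ _ Hb (Rmin_r _ _)).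
  assert (Hm := Rlt_le_trans _ _ _ Hd (Rmin_l _ _)).
  assert (Hn := Rlt_le_trans _ _ _ Hd (Rmin_r _ _)).
  assert (Hx := re_le_Cmod w). assert (Hy := Im_le_Cmod w).
  rewrite Cexp_0.
  set (x := Re w) in *. set (y := Im w) in *.
  specialize (H1 x (Rle_lt_trans _ _ _ Hx Hc)).
  specialize (H2 y (Rle_lt_trans _ _ _ Hy Hm)).
  specialize (H3 y (Rle_lt_trans _ _ _ Hy Hn)).
  rewrite exp_0 in H1. rewrite cos_0 in H2. rewrite sin_0 in H3.
  apply Rle_trans with (1 := Cmod_le_Re_Im _).
  replace (Re (Cexp w - 1 - 1 * w)) with ((exp x - 1 - x * 1) + exp x * (cos y - 1 - y * 0))
    by (destruct w; unfold x, y, Cexp, Re, Im, Cminus, Cplus, Copp, Cmult, RtoC; simpl; ring).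
  replace (Im (Cexp w - 1 - 1 * w))
    with (exp x * (sin y - 0 - y * 1) + (exp x - 1 - x * 1) * y + x * y)
    by (destruct w; unfold x, y, Cexp, Re, Im, Cminus, Cplus, Copp, Cmult, RtoC; simpl; ring).
  set (E := exp x - 1 - x * 1) in *. set (F := cos y - 1 - y * 0) in *.
  set (G := sin y - 0 - y * 1) in *.
  assert (Hx0 := Rabs_pos x). assert (Hy0 := Rabs_pos y). set (m := Cmod w) in *.
  assert (HE : Rabs E <= e * m) by (apply Rle_trans with (1 := H1); apply Rmult_le_compat_l; lra).
  assert (HF : Rabs F <= e * m) by (apply Rle_trans with (1 := H2); apply Rmult_le_compat_l; lra).
  assert (HG : Rabs G <= e * m) by (apply Rle_trans with (1 := H3); apply Rmult_le_compat_l; lra).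
  assert (Hexp : Rabs (exp x) <= 2).
  { replace (exp x) with (E + (1 + x)) by (unfold E; ring).
    assert (T := Rabs_triang E (1 + x)). assert (T1 := Rabs_triang 1 x).
    rewrite Rabs_R1 in T1. nra. }
  assert (T1 := Rabs_triang E (exp x * F)).
  assert (T2 := Rabs_triang (exp x * G + E * y) (x * y)).
  assert (T3 := Rabs_triang (exp x * G) (E * y)).
  rewrite !Rabs_mult in *.
  assert (Hm0 : 0 <= m) by apply Cmod_ge_0.
  assert (A1 : Rabs (exp x) * Rabs F <= 2 * (e * m))
    by (apply Rmult_le_compat; try apply Rabs_pos; lra).
  assert (A2 : Rabs (exp x) * Rabs G <= 2 * (e * m))
    by (apply Rmult_le_compat; try apply Rabs_pos; lra).
  assert (A3 : Rabs E * Rabs y <= (e * m) * 1)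
    by (apply Rmult_le_compat; try apply Rabs_pos; lra).
  assert (A4 : Rabs x * Rabs y <= e * m)
    by (apply Rmult_le_compat; try apply Rabs_pos; lra).
  assert (A5 : e * m <= eps / 10 * m) by (apply Rmult_le_compat_r; lra).
  assert (A6 : 0 <= eps * m) by (apply Rmult_le_pos; lra).
  lra.
Qed.

Lemma cdiff_Cexp z : cdiff total Cexp z (Cexp z).
Proof.
  apply (cdiff_ext total (fun w => Cexp z * Cexp (w + - z))%C); [exact I| |].
  { intros w _. rewrite <- Cexp_plus. f_equal. ring. }
  apply (cdiff_eq _ _ _ (Cexp z * (1 * (1 + 0)))%C); [|ring].
  apply cdiff_scal.
  apply (cdiff_comp total total (fun w => w + - z)%C Cexp); [| |easy].
  - apply cdiff_plus; [apply cdiff_id|apply cdiff_const].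
  - replace (z + - z)%C with (RtoC 0) by ring. apply cdiff_Cexp_0.
Qed.

Lemma ccont_RtoC_comp A (h : C -> R) (phi : R -> R) z :
  ccont A (fun w => RtoC (h w)) z -> continuity_pt phi (h z) ->
  ccont A (fun w => RtoC (phi (h w))) z.
Proof.
  intros H Hp eps He. destruct (Hp eps He) as [d1 [Hd1 H1]].
  destruct (H d1 Hd1) as [d [Hd H2]]. exists d. split; [exact Hd|].
  intros w Hw Hwd. specialize (H2 w Hw Hwd). rewrite Cmod_RtoC_sub in *.
  destruct (Req_dec (h w) (h z)) as [E|E].
  - rewrite E, Rminus_diag, Rabs_R0. exact He.
  - apply H1. split; [split; [exact I|auto]|exact H2].
Qed.

Lemma ccont_RtoC_lipschitz A (h : C -> R) z :
  (forall w, Rabs (h w - h z) <= Cmod (w - z)) -> ccont A (fun w => RtoC (h w)) z.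
Proof.
  intros H eps He. exists eps. split; [exact He|]. intros w _ Hw.
  rewrite Cmod_RtoC_sub. apply Rle_lt_trans with (1 := H w). exact Hw.
Qed.

Lemma ccont_Re A z : ccont A (fun w => RtoC (Re w)) z.
Proof.
  apply ccont_RtoC_lipschitz. intros w.
  replace (Re w - Re z) with (Re (w - z)); [apply re_le_Cmod|].
  unfold Re, Cminus, Cplus, Copp; simpl; ring.
Qed.

Lemma ccont_Im A z : ccont A (fun w => RtoC (Im w)) z.
Proof.
  apply ccont_RtoC_lipschitz. intros w.
  replace (Im w - Im z) with (Im (w - z)); [apply Im_le_Cmod|].
  unfold Im, Cminus, Cplus, Copp; simpl; ring.
Qed.

Lemma ccont_Cmod A z : ccont A (fun w => RtoC (Cmod w)) z.
Proof.
  apply ccont_RtoC_lipschitz. intros w. apply Rabs_le.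
  assert (H1 := Cmod_sub_le w z). assert (H2 := Cmod_sub_le z w).
  rewrite Cmod_sub_sym in H2. lra.
Qed.

Lemma UH_neq_0 z : UH z -> z <> 0.
Proof. intros H ->. unfold UH, Im, RtoC in H; simpl in H. lra. Qed.

Lemma near_UH z w : Cmod (w - z) < Im z -> UH w.
Proof.
  intros Hw. assert (H := Im_le_Cmod (w - z)). unfold Cminus in H at 1.
  rewrite im_plus, im_opp in H.
  assert (H1 := Rle_abs (- (Im w + - Im z))). rewrite Rabs_Ropp in H1.
  unfold UH. lra.
Qed.

Lemma ccont_Clog z : UH z -> ccont UH Clog z.
Proof.
  intros Hz. assert (Hn := UH_neq_0 z Hz).
  apply (ccont_ext UH (fun w => RtoC (ln (Cmod w))
    + Ci * RtoC (PI / 2 - atan (Re w / Im w)))%C); [exact Hz| |].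
  { intros w _. unfold Clog, RtoC, Ci, Cmult, Cplus; simpl. f_equal; ring. }
  apply ccont_plus; [|apply ccont_mult; [apply ccont_const|]].
  - apply (ccont_RtoC_comp UH Cmod ln); [apply ccont_Cmod|].
    apply derivable_continuous_pt. exists (/ Cmod z). apply derivable_pt_lim_ln.
    now apply Cmod_gt_0.
  - apply (ccont_RtoC_comp UH (fun w => Re w / Im w) (fun x => PI / 2 - atan x)).
    + apply (ccont_ext UH (fun w => RtoC (Re w) * / RtoC (Im w))%C); [exact Hz| |].
      { intros w Hw. rewrite RtoC_div; [reflexivity|]. unfold UH in Hw. lra. }
      apply ccont_mult; [apply ccont_Re|]. apply ccont_inv; [apply ccont_Im|].
      intros H. apply RtoC_inj in H. unfold UH in Hz. lra.
    + apply continuity_pt_minus; [now apply continuity_pt_const|].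
      apply derivable_continuous_pt, derivable_pt_atan.
Qed.

Lemma cdiff_Clog z : UH z -> cdiff UH Clog z (/ z)%C.
Proof.
  intros Hz. apply (cdiff_inverse total UH Cexp); auto using ccont_Clog, UH_neq_0.
  - easy.
  - intros w Hw. now apply Cexp_Clog.
  - now apply Cexp_Clog.
  - assert (H := cdiff_Cexp (Clog z)). rewrite (Cexp_Clog z Hz) in H. exact H.
Qed.

Lemma Im_Clog_bounds z : 0 < Im (Clog z) < PI.
Proof.
  unfold Clog, Im; simpl. assert (H := atan_bound (Re z / snd z)). lra.
Qed.

(** * Compactness and the open mapping property *)

(** A covering argument.  Near a point off [K] the local bound can hold vacuously,
    which is how closedness of [K] enters in the applications. *)
Lemma compact_positive (K : C -> Prop) (F : C -> R) B :
  (forall z, K z -> Cmod z <= B) ->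
  (forall z, exists del, 0 < del /\ forall w, K w -> Cmod (w - z) < del -> del <= F w) ->
  exists eps, 0 < eps /\ forall z, K z -> eps <= F z.
Proof.
  intros HB HF.
  set (del := fun z => proj1_sig (constructive_indefinite_description _ (HF z))).
  assert (Hdel : forall z, 0 < del z /\
    forall w, K w -> Cmod (w - z) < del z -> del z <= F w).
  { intros z. unfold del. apply proj2_sig. }
  assert (Hpos : forall u v, 0 < del (u, v) / 2).
  { intros u v. destruct (Hdel (u, v)). lra. }
  destruct (compactness_value_2d (- B) B (- B) B (fun u v => mkposreal _ (Hpos u v)))
    as [d Hd].
  exists d. split; [apply cond_pos|]. intros [x y] Hz.
  assert (Hx := re_le_Cmod (x, y)). assert (Hy := Im_le_Cmod (x, y)).
  specialize (HB _ Hz). unfold Re, Im in Hx, Hy; simpl in Hx, Hy.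
  destruct (Rle_or_lt d (F (x, y))) as [H|H]; [exact H|].
  exfalso. apply (Hd x y).
  - apply Rabs_le_between. lra.
  - apply Rabs_le_between. lra.
  - intros [u [v [_ [_ [H1 [H2 H3]]]]]]. simpl in H1, H2, H3.
    destruct (Hdel (u, v)) as [H4 H5].
    assert (H6 : del (u, v) <= F (x, y)); [|lra].
    apply H5; [exact Hz|]. apply Rle_lt_trans with (1 := Cmod_le_Re_Im _).
    unfold Re, Im; simpl. unfold Rminus in H1, H2. lra.
Qed.

Lemma compact_min (K : C -> Prop) (F : C -> R) B z1 :
  (forall z, K z -> Cmod z <= B) ->
  (forall z, ~ K z -> exists del, 0 < del /\ forall w, Cmod (w - z) < del -> ~ K w) ->
  K z1 -> (forall z, 0 <= F z) ->
  (forall z, K z -> ccont K (fun w => RtoC (F w)) z) ->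
  exists z0, K z0 /\ forall z, K z -> F z0 <= F z.
Proof.
  intros HB Hcl Hz1 HF0 HF.
  destruct (completeness (fun x => exists z, K z /\ x = - F z)) as [m [Hm1 Hm2]].
  { exists 0. intros x [z [_ ->]]. specialize (HF0 z). lra. }
  { exists (- F z1). eauto. }
  destruct (classic (exists z0, K z0 /\ F z0 = - m)) as [[z0 [H1 H2]]|Hno].
  { exists z0. split; [exact H1|]. intros z Hz.
    assert (- F z <= m) by (apply Hm1; eauto). lra. }
  exfalso.
  destruct (compact_positive K (fun z => F z + m) B HB) as [eps [He H]].
  - intros z. destruct (classic (K z)) as [Hz|Hz].
    + assert (H1 : - F z <= m) by (apply Hm1; eauto).
      assert (H2 : F z <> - m) by (intros E; apply Hno; eauto).
      destruct (HF z Hz ((F z + m) / 2)) as [d [Hd H]]; [lra|].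
      exists (Rmin d ((F z + m) / 2)). split; [apply Rmin_pos; lra|].
      intros w Hw Hwd.
      specialize (H w Hw (Rlt_le_trans _ _ _ Hwd (Rmin_l _ _))).
      rewrite Cmod_RtoC_sub in H. apply Rabs_def2 in H.
      assert (H3 := Rmin_r d ((F z + m) / 2)). lra.
    + destruct (Hcl z Hz) as [d [Hd H]]. exists d. split; [exact Hd|].
      intros w Hw Hwd. now elim (H w Hwd).
  - assert (H1 : m <= m - eps); [|lra]. apply Hm2.
    intros x [z [Hz ->]]. specialize (H z Hz). lra.
Qed.

Definition disc (z0 : C) (r : R) (z : C) : Prop := Cmod (z - z0) < r.

Lemma disc_center z0 r : 0 < r -> disc z0 r z0.
Proof.
  intros Hr. unfold disc. replace (z0 - z0)%C with (RtoC 0) by ring. now rewrite Cmod_0.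
Qed.

(** At a minimum of [|f - w|] with [f <> w], a Newton step towards [w] would
    decrease [|f - w|]; so an interior minimum is a zero.  The derivative at the
    centre keeps the minimum off the boundary of a small disc. *)
Lemma open_mapping (f df : C -> C) z0 r : 0 < r ->
  (forall z, disc z0 r z -> cdiff (disc z0 r) f z (df z)) ->
  (forall z, disc z0 r z -> df z <> 0) ->
  exists del, 0 < del /\ forall w, Cmod (w - f z0) < del ->
    exists z, disc z0 r z /\ f z = w.
Proof.
  intros Hr Hf Hdf.
  assert (Hz0 := disc_center z0 r Hr).
  assert (HD : 0 < Cmod (df z0)) by (apply Cmod_gt_0, Hdf, Hz0).
  set (c := Cmod (df z0) / 2).
  destruct (cdiff_eps _ _ _ _ (Hf z0 Hz0) c) as [d [Hd H1]]; [unfold c; lra|].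
  set (rho := Rmin r d / 2).
  assert (Hrho : 0 < rho) by (unfold rho; assert (0 < Rmin r d) by (now apply Rmin_pos); lra).
  assert (Hr1 : rho < r) by (unfold rho in *; assert (H := Rmin_l r d); lra).
  assert (Hr2 : rho < d) by (unfold rho in *; assert (H := Rmin_r r d); lra).
  assert (Hfar : forall z, Cmod (z - z0) <= rho -> c * Cmod (z - z0) <= Cmod (f z - f z0)).
  { intros z Hz. specialize (H1 z). unfold disc in H1.
    assert (H2 := H1 ltac:(lra) ltac:(lra)).
    assert (H3 := Cmod_sub_le (df z0 * (z - z0)) (- (f z - f z0 - df z0 * (z - z0)))).
    rewrite Cmod_opp, Cmod_mult in H3.
    replace (df z0 * (z - z0) - - (f z - f z0 - df z0 * (z - z0)))%C
      with (f z - f z0)%C in H3 by ring. unfold c in *. lra. }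
  assert (Hc : 0 < c) by (unfold c; lra).
  exists (c * rho / 3). split; [apply Rdiv_lt_0_compat; [nra|lra]|].
  intros w Hw.
  set (K := fun z => Cmod (z - z0) <= rho).
  destruct (compact_min K (fun z => Cmod (f z - w)) (rho + Cmod z0) z0)
    as [z1 [Hz1 Hmin]].
  - intros z Hz. assert (H := Cmod_sub_le z z0). unfold K in Hz. lra.
  - intros z Hz. exists (Cmod (z - z0) - rho). unfold K in *. split; [lra|].
    intros v Hv Hv'. assert (H := Cmod_sub_triangle z v z0).
    rewrite Cmod_sub_sym in Hv. lra.
  - unfold K. replace (z0 - z0)%C with (RtoC 0) by ring. rewrite Cmod_0. lra.
  - intros; apply Cmod_ge_0.
  - intros z Hz. apply (ccont_comp K total (fun v => f v + - w)%C (fun v => RtoC (Cmod v))).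
    + apply ccont_plus; [|apply ccont_const].
      apply (ccont_subset K (disc z0 r)); [intros v Hv; unfold K, disc in *; lra|].
      apply (cdiff_ccont _ _ _ (df z)), Hf. unfold K, disc in *; lra.
    + apply ccont_Cmod.
    + easy.
  - assert (HK0 : K z0).
    { unfold K. replace (z0 - z0)%C with (RtoC 0) by ring. rewrite Cmod_0. lra. }
    assert (Hm := Hmin z0 HK0). cbv beta in Hm. rewrite Cmod_sub_sym in Hw.
    assert (Hint : Cmod (z1 - z0) < rho).
    { destruct Hz1 as [H|H]; [exact H|]. exfalso.
      assert (H2 := Hfar z1 (Req_le _ _ H)). rewrite H in H2.
      assert (H3 := Cmod_sub_triangle (f z1) w (f z0)).
      rewrite (Cmod_sub_sym w) in H3. nra. }
    assert (Hd1 : disc z0 r z1) by (unfold disc; lra).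
    exists z1. split; [exact Hd1|].
    apply Ceq_minus. destruct (classic ((f z1 - w)%C = 0)) as [E|Hne]; [exact E|exfalso].
    assert (Hdf1 := Hdf z1 Hd1).
    set (m := Cmod (f z1 - w)) in *.
    assert (Hm0 : 0 < m) by (now apply Cmod_gt_0).
    set (D := Cmod (df z1)). assert (HD1 : 0 < D) by (now apply Cmod_gt_0).
    destruct (cdiff_eps _ _ _ _ (Hf z1 Hd1) (D / 2)) as [d1 [Hdd1 H2]]; [lra|].
    set (s := Rmin d1 (rho - Cmod (z1 - z0)) / 2).
    assert (Hs : 0 < s).
    { assert (0 < Rmin d1 (rho - Cmod (z1 - z0))) by (apply Rmin_pos; lra).
      unfold s; lra. }
    assert (Hs1 : s < d1).
    { assert (H := Rmin_l d1 (rho - Cmod (z1 - z0))). unfold s in *; lra. }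
    assert (Hs2 : s < rho - Cmod (z1 - z0)).
    { assert (H := Rmin_r d1 (rho - Cmod (z1 - z0))). unfold s in *; lra. }
    (* The fraction of the Newton step that fits into both neighbourhoods of [z1]. *)
    set (eta := Rmin 1 (D / m * s)).
    assert (Heta : 0 < eta).
    { apply Rmin_pos; [lra|]. apply Rmult_lt_0_compat; [|exact Hs].
      now apply Rdiv_lt_0_compat. }
    assert (Heta1 : eta <= 1) by apply Rmin_l.
    assert (Heta2 : eta * m / D <= s).
    { apply Rle_trans with (D / m * s * m / D).
      - apply Rmult_le_compat_r; [left; now apply Rinv_0_lt_compat|].
        apply Rmult_le_compat_r; [lra|]. apply Rmin_r.
      - right. field. lra. }
    set (h := (- (RtoC eta * (f z1 - w)) / df z1)%C).
    assert (Hh : Cmod h = eta * m / D).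
    { unfold h. rewrite Cmod_div by exact Hdf1.
      rewrite Cmod_opp, Cmod_mult, Cmod_R, Rabs_pos_eq by lra. reflexivity. }
    specialize (H2 (z1 + h)%C).
    replace (z1 + h - z1)%C with h in H2 by ring.
    assert (Hz1h : Cmod (z1 + h - z0) <= Cmod (z1 - z0) + s).
    { replace (z1 + h - z0)%C with ((z1 - z0) + h)%C by ring.
      apply Rle_trans with (1 := Cmod_triangle _ _). lra. }
    assert (H3 : Cmod (f (z1 + h)%C - f z1 - df z1 * h) <= D / 2 * Cmod h).
    { apply H2; [unfold disc|]; lra. }
    assert (H4 := Hmin (z1 + h)%C ltac:(unfold K; lra)). cbv beta in H4. fold m in H4.
    assert (H5 : Cmod (f (z1 + h)%C - w)
      <= Cmod (f (z1 + h)%C - f z1 - df z1 * h) + (1 - eta) * m).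
    { replace (f (z1 + h)%C - w)%C with
        ((f (z1 + h)%C - f z1 - df z1 * h) + RtoC (1 - eta) * (f z1 - w))%C.
      - apply Rle_trans with (1 := Cmod_triangle _ _).
        rewrite Cmod_mult, Cmod_R, Rabs_pos_eq by lra. fold m. lra.
      - unfold h. rewrite RtoC_minus. field. exact Hdf1. }
    rewrite Hh in H3. replace (D / 2 * (eta * m / D)) with (eta * m / 2) in H3
      by (field; lra).
    assert (0 < eta * m) by (now apply Rmult_lt_0_compat). lra.
Qed.

(** * The map k *)

Definition admissible (kappa : R) : Prop := -4 < kappa < 4.

Definition base_log (kappa : R) (z : C) : C := Clog (z - Cconj (beta kappa)).

(** The half-plane above [Cconj (beta kappa)], on which [k kappa] is analytic. *)
Definition above (kappa : R) (z : C) : Prop := - (2 * cos (theta kappa)) < Im z.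

(** The derivative of [k kappa]. *)
Definition dk (kappa : R) (z : C) : C :=
  (RtoC (2 * cos (theta kappa)) * eith kappa * (z - kappa)
   * Cexp (eith kappa * eith kappa * base_log kappa z)
   / (z - Cconj (beta kappa)) / k_num kappa kappa)%C.

Lemma sin_theta kappa : admissible kappa -> kappa = - 4 * sin (theta kappa).
Proof.
  intros [H1 H2]. unfold theta. rewrite sin_neg, sin_asin by lra. field.
Qed.

Lemma cos_theta_pos kappa : admissible kappa -> 0 < cos (theta kappa).
Proof.
  intros [H1 H2]. unfold theta.
  destruct (asin_bound_lt (kappa / 4)); [lra|]. apply cos_gt_0; lra.
Qed.

Lemma eith_eq kappa : eith kappa = (cos (theta kappa), sin (theta kappa)).
Proof.
  unfold eith, Cexp, Ci, RtoC, Re, Im; simpl.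
  replace (0 * theta kappa - 1 * 0) with 0 by ring.
  replace (0 * 0 + 1 * theta kappa) with (theta kappa) by ring.
  rewrite exp_0. f_equal; ring.
Qed.

Lemma eith_neq_0 kappa : eith kappa <> 0.
Proof. apply Cexp_neq_0. Qed.

Lemma Cconj_eith kappa : Cconj (eith kappa) = (/ eith kappa)%C.
Proof.
  unfold eith. rewrite <- Cexp_conj, <- Cexp_opp. f_equal.
  unfold Cconj, Copp, Cmult, Ci, RtoC; simpl. f_equal; ring.
Qed.

Lemma eith_sqr kappa : Cexp (2 * Ci * theta kappa) = (eith kappa * eith kappa)%C.
Proof. unfold eith. rewrite <- Cexp_plus. f_equal. ring. Qed.

Lemma eith_sum kappa : RtoC (2 * cos (theta kappa)) = (eith kappa + / eith kappa)%C.
Proof.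
  rewrite <- Cconj_eith, eith_eq. unfold RtoC, Cconj, Cplus; simpl. f_equal; ring.
Qed.

Lemma Cconj_beta kappa : Cconj (beta kappa) = (- (2 * Ci) / eith kappa)%C.
Proof.
  unfold beta. rewrite !Cmult_conj, Cconj_eith.
  replace (Cconj 2) with (RtoC 2) by (unfold Cconj, RtoC; simpl; f_equal; ring).
  replace (Cconj Ci) with (- Ci)%C
    by (unfold Cconj, Ci, RtoC, Copp; simpl; f_equal; ring).
  field. apply eith_neq_0.
Qed.

Lemma beta_eq kappa : beta kappa = (- 2 * sin (theta kappa), 2 * cos (theta kappa)).
Proof.
  unfold beta. rewrite eith_eq. unfold Ci, RtoC, Cmult; simpl. f_equal; ring.
Qed.

Lemma beta_sum kappa : admissible kappa -> RtoC kappa = (beta kappa + Cconj (beta kappa))%C.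
Proof.
  intros H. rewrite beta_eq. apply sin_theta in H. unfold RtoC, Cconj, Cplus; simpl.
  f_equal; lra.
Qed.

Lemma beta_diff kappa : (beta kappa - Cconj (beta kappa))%C
  = (2 * Ci * RtoC (2 * cos (theta kappa)))%C.
Proof.
  rewrite beta_eq. unfold Cconj, RtoC, Ci, Cminus, Cplus, Copp, Cmult; simpl.
  f_equal; ring.
Qed.

Lemma Ci_sqr : (Ci * Ci = - (1))%C.
Proof. unfold Ci, RtoC, Cmult, Copp; simpl. f_equal; ring. Qed.

Lemma UH_beta kappa : admissible kappa -> UH (beta kappa).
Proof.
  intros H. rewrite beta_eq. unfold UH, Im; simpl. apply cos_theta_pos in H. lra.
Qed.

Lemma above_UH kappa z : above kappa z -> UH (z - Cconj (beta kappa)).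
Proof.
  rewrite beta_eq. destruct z as [x y]. unfold above, UH, Im, Cconj, Cminus, Cplus, Copp.
  simpl. lra.
Qed.

Lemma nonneg_above kappa z : admissible kappa -> 0 <= Im z -> above kappa z.
Proof. intros H Hz. apply cos_theta_pos in H. unfold above. lra. Qed.

Lemma real_above kappa (x : R) : admissible kappa -> above kappa x.
Proof. intros H. apply nonneg_above; [exact H|]. rewrite im_RtoC. lra. Qed.

Lemma above_sub_neq_0 kappa z : above kappa z -> (z - Cconj (beta kappa))%C <> 0.
Proof. intros H. now apply UH_neq_0, above_UH. Qed.

Lemma real_sub_beta_neq_0 kappa (x : R) : admissible kappa -> (x - beta kappa)%C <> 0.
Proof.
  intros H E. apply UH_beta in H. apply (f_equal Im) in E.
  unfold UH in H. unfold Cminus in E. rewrite im_plus, im_opp, !im_RtoC in E. lra.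
Qed.

Lemma k_num_eq kappa z : k_num kappa z
  = ((z - beta kappa) * Cexp (eith kappa * eith kappa * base_log kappa z))%C.
Proof. unfold k_num, Cpower. now rewrite eith_sqr. Qed.

Lemma k_num_kappa_neq_0 kappa : admissible kappa -> k_num kappa kappa <> 0.
Proof.
  intros H. rewrite k_num_eq. apply Cmult_neq_0; [|apply Cexp_neq_0].
  now apply real_sub_beta_neq_0.
Qed.

Lemma k_beta kappa : admissible kappa -> k kappa (beta kappa) = 0.
Proof.
  intros H. unfold k. rewrite (k_num_eq kappa (beta kappa)). field. now apply k_num_kappa_neq_0.
Qed.

Lemma k_kappa kappa : admissible kappa -> k kappa kappa = 1.
Proof. intros H. unfold k. field. now apply k_num_kappa_neq_0. Qed.

Lemma cdiff_base_log kappa z : above kappa z ->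
  cdiff (above kappa) (base_log kappa) z (/ (z - Cconj (beta kappa)))%C.
Proof.
  intros Hz. apply (cdiff_eq _ _ _ (/ (z + - Cconj (beta kappa)) * (1 + 0))%C);
    [|unfold Cminus; ring].
  apply (cdiff_comp (above kappa) UH (fun w => w + - Cconj (beta kappa))%C Clog).
  - apply cdiff_plus; [apply cdiff_id|apply cdiff_const].
  - apply cdiff_Clog. now apply above_UH.
  - intros w Hw. now apply above_UH.
Qed.

(** Logarithmic differentiation gives [k' / k = 1 / (z - beta) + e / (z - conj beta)]
    with [e = eith ^ 2]; the numerator of the sum is
    [(1 + e) z - (conj beta + e beta) = 2 cos theta * eith * (z - kappa)]. *)
Lemma cdiff_k kappa z : admissible kappa -> above kappa z ->
  cdiff (above kappa) (k kappa) z (dk kappa z).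
Proof.
  intros Ha Hz. assert (He := eith_neq_0 kappa).
  assert (HN := k_num_kappa_neq_0 kappa Ha).
  assert (Hb := above_sub_neq_0 kappa z Hz).
  apply (cdiff_ext _ (fun w => / k_num kappa kappa * ((w + - beta kappa)
    * Cexp (eith kappa * eith kappa * base_log kappa w)))%C); [exact Hz| |].
  { intros w _. unfold k. rewrite (k_num_eq kappa w). field. exact HN. }
  eapply cdiff_eq.
  - apply cdiff_scal. apply cdiff_mult.
    + apply cdiff_plus; [apply cdiff_id|apply cdiff_const].
    + apply (cdiff_comp (above kappa) total
        (fun w => eith kappa * eith kappa * base_log kappa w)%C Cexp);
        [|apply cdiff_Cexp|easy].
      apply cdiff_scal. apply cdiff_base_log. exact Hz.
  - cbv beta. unfold dk. set (N := k_num kappa kappa) in *.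
    rewrite (beta_sum kappa Ha), eith_sum.
    rewrite Cconj_beta in *. unfold beta.
    field. repeat split; try assumption.
    intros E. apply Hb.
    transitivity (0 / eith kappa)%C; [rewrite <- E|]; field; exact He.
Qed.

Lemma dk_neq_0 kappa z : admissible kappa -> above kappa z -> z <> RtoC kappa -> dk kappa z <> 0.
Proof.
  intros Ha Hz Hk. unfold dk, Cdiv.
  repeat apply Cmult_neq_0; try apply Cexp_neq_0.
  - intros H. apply RtoC_inj in H. apply cos_theta_pos in Ha. lra.
  - now apply Cminus_eq_contra.
  - apply Cmod_gt_0. rewrite Cmod_inv by (now apply above_sub_neq_0).
    apply Rinv_0_lt_compat, Cmod_gt_0. now apply above_sub_neq_0.
  - apply Cmod_gt_0. rewrite Cmod_inv by (now apply k_num_kappa_neq_0).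
    apply Rinv_0_lt_compat, Cmod_gt_0. now apply k_num_kappa_neq_0.
Qed.

Lemma UH_neq_real z (x : R) : UH z -> z <> RtoC x.
Proof. intros H ->. unfold UH in H. rewrite im_RtoC in H. lra. Qed.

(** The reciprocal of the logarithmic derivative, as
    [(z - beta) (z - conj beta) = z^2 - kappa z + 4]. *)
Lemma k_div_dk kappa z : admissible kappa -> above kappa z -> z <> RtoC kappa ->
  (RtoC (cos (theta kappa)) * eith kappa * k kappa z / dk kappa z
   = (z * z - kappa * z + 4) / (2 * (z - kappa)))%C.
Proof.
  intros Ha Hz Hk.
  assert (Hb := above_sub_neq_0 kappa z Hz).
  assert (HN := k_num_kappa_neq_0 kappa Ha).
  assert (Hc : RtoC (cos (theta kappa)) <> 0).
  { intros H. apply RtoC_inj in H. apply cos_theta_pos in Ha. lra. }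
  assert (He := eith_neq_0 kappa). assert (Hk' := Cminus_eq_contra _ _ Hk).
  assert (HE := Cexp_neq_0 (eith kappa * eith kappa * base_log kappa z)).
  assert (H4 : (z * z - kappa * z + 4
    = (z - beta kappa) * (z - Cconj (beta kappa)))%C).
  { rewrite (beta_sum kappa Ha), Cconj_beta. unfold beta.
    transitivity (z * z - (2 * Ci * eith kappa + - (2 * Ci) / eith kappa) * z
      - 4 * (Ci * Ci))%C; [rewrite Ci_sqr; ring|field; exact He]. }
  rewrite H4. unfold dk, k. rewrite (k_num_eq kappa z).
  rewrite RtoC_mult. field. repeat split; assumption.
Qed.

(** ** Values on the real line *)

(** The parameter on the spiral of the value of [k] at a real point. *)
Definition height (kappa x : R) : R :=
  2 * Re (eith kappa * base_log kappa x) - 2 * Re (eith kappa * base_log kappa kappa).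

(** On the real line the factor [x - beta] is conjugate to [x - conj beta], so the
    exponent [conj c + eith^2 c], where [c = log (x - conj beta)], is [eith] times the
    real number [conj (eith c) + eith c]. *)
Lemma k_num_real kappa (x : R) : admissible kappa ->
  k_num kappa x = Cexp (eith kappa * RtoC (2 * Re (eith kappa * base_log kappa x))).
Proof.
  intros Ha. assert (He := eith_neq_0 kappa).
  rewrite k_num_eq.
  replace (x - beta kappa)%C with (Cconj (x - Cconj (beta kappa))).
  2:{ rewrite Cminus_conj, Cconj_conj. f_equal.
      unfold Cconj, RtoC; simpl. f_equal; ring. }
  rewrite <- (Cexp_Clog (x - Cconj (beta kappa))) by (now apply above_UH, real_above).
  fold (base_log kappa x). rewrite <- Cexp_conj, <- Cexp_plus. f_equal.
  rewrite RtoC_mult, re_alt, Cmult_conj, Cconj_eith. field. exact He.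
Qed.

Lemma k_real kappa (x : R) : admissible kappa ->
  k kappa x = Cexp (RtoC (height kappa x) * eith kappa).
Proof.
  intros Ha. unfold k, Cdiv. rewrite !k_num_real, <- Cexp_opp, <- Cexp_plus by exact Ha.
  f_equal. unfold height. rewrite RtoC_minus. ring.
Qed.

Lemma height_kappa kappa : height kappa kappa = 0.
Proof. unfold height. ring. Qed.

(** The derivative of [height] at [xi] is [2 cos theta (xi - kappa) / |xi - beta|^2]. *)
Lemma height_MVT kappa a b : admissible kappa -> a < b -> exists xi, a < xi < b /\
  exists q, 0 < q /\ height kappa b - height kappa a = (b - a) * (xi - kappa) * q.
Proof.
  intros Ha Hab.
  destruct (curve_MVT (base_log kappa) (fun s => / (s - Cconj (beta kappa)))%C a b
    (2 * eith kappa)%C Hab) as [xi [Hxi E]].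
  { intros s Hs. apply (cdiff_subset _ (above kappa)).
    - intros w Hw. rewrite (reals_eq _ _ Hw). now apply real_above.
    - apply cdiff_base_log. now apply real_above. }
  exists xi. split; [exact Hxi|].
  assert (Hc := cos_theta_pos kappa Ha). assert (Hs := sin_theta kappa Ha).
  set (m := (xi + 2 * sin (theta kappa)) ^ 2 + (2 * cos (theta kappa)) ^ 2).
  assert (Hm : 0 < m) 
    by (unfold m; apply Rplus_le_lt_0_compat; [apply pow2_ge_0|apply pow_lt; lra]).
  exists (2 * cos (theta kappa) / m). split; [apply Rdiv_lt_0_compat; lra|].
  replace (height kappa b - height kappa a)
    with (Re (2 * eith kappa * (base_log kappa b - base_log kappa a))).
  - rewrite E. rewrite Rmult_assoc. f_equal.
    rewrite beta_eq, eith_eq.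
    unfold Re, Cmult, Cinv, Cminus, Cplus, Copp, Cconj, RtoC; simpl.
    set (S := sin (theta kappa)) in *. set (D := cos (theta kappa)) in *.
    replace ((xi + - (-2 * S)) * ((xi + - (-2 * S)) * 1)
      + (0 + - - (2 * D)) * ((0 + - - (2 * D)) * 1)) with m by (unfold m; ring).
    rewrite Hs. field. lra.
  - unfold height. rewrite !(re_mult). unfold Re, Im, Cmult, Cminus, Cplus, Copp, RtoC; simpl. ring.
Qed.

Lemma height_pos kappa x : admissible kappa -> x <> kappa -> 0 < height kappa x.
Proof.
  intros Ha Hx. assert (H0 := height_kappa kappa).
  destruct (Rtotal_order x kappa) as [H|[H|H]]; [|contradiction|].
  - destruct (height_MVT kappa x kappa Ha H) as [xi [Hxi [q [Hq E]]]].
    assert (0 < (kappa - x) * (kappa - xi) * q) by (repeat apply Rmult_lt_0_compat; lra). nra.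
  - destruct (height_MVT kappa kappa x Ha H) as [xi [Hxi [q [Hq E]]]].
    assert (0 < (x - kappa) * (xi - kappa) * q) by (repeat apply Rmult_lt_0_compat; lra). nra.
Qed.

Lemma height_continuity kappa : admissible kappa -> continuity (height kappa).
Proof.
  intros Ha x eps He.
  assert (H : ccont (above kappa) (fun w => 2 * eith kappa * base_log kappa w)%C x).
  { apply ccont_mult; [apply ccont_const|].
    apply (cdiff_ccont _ _ _ _ (cdiff_base_log kappa x (real_above kappa x Ha))). }
  destruct (H eps He) as [d [Hd H1]]. exists d. split; [exact Hd|].
  intros y [_ Hy]. simpl in Hy |- *. unfold R_dist in *.
  specialize (H1 (RtoC y) (real_above kappa y Ha)). rewrite Cmod_RtoC_sub in H1.
  apply Rle_lt_trans with (2 := H1 Hy).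
  replace (height kappa y - height kappa x)
    with (Re (2 * eith kappa * base_log kappa y - 2 * eith kappa * base_log kappa x)).
  - apply re_le_Cmod.
  - unfold height. unfold Re, Im, Cmult, Cminus, Cplus, Copp, RtoC; simpl. ring.
Qed.

Lemma height_unbounded kappa M : admissible kappa ->
  exists x, kappa <= x /\ M <= height kappa x.
Proof.
  intros Ha. assert (Hc := cos_theta_pos kappa Ha). assert (Hs := sin_theta kappa Ha).
  set (D := cos (theta kappa)) in *. set (S := sin (theta kappa)) in *.
  assert (HS : -1 <= S <= 1) by apply SIN_bound.
  set (A := (M + 2 * PI + 2 * Re (eith kappa * base_log kappa kappa)) / (2 * D)).
  exists (kappa + exp A + 4). assert (HA := exp_pos A). split; [lra|].
  set (x := kappa + exp A + 4).
  assert (Hm : exp A <= Cmod (x - Cconj (beta kappa))).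
  { apply Rle_trans with (2 := re_le_Cmod _).
    rewrite beta_eq. unfold Re, Cconj, Cminus, Cplus, Copp, RtoC; simpl. fold S.
    apply Rle_trans with (2 := Rle_abs _). unfold x. lra. }
  assert (Hl : A <= Re (base_log kappa x)).
  { unfold base_log, Clog, Re; simpl. rewrite <- (ln_exp A). now apply ln_le. }
  assert (Hi := Im_Clog_bounds (x - Cconj (beta kappa))). fold (base_log kappa x) in Hi.
  unfold height. rewrite (re_mult (eith kappa) (base_log kappa x)).
  rewrite eith_eq at 1 2. unfold Re at 1, Im at 1; simpl fst; simpl snd. fold D. fold S.
  assert (H1 : D * A <= D * Re (base_log kappa x)) by (apply Rmult_le_compat_l; lra).
  assert (H2 : 2 * (D * A) = M + 2 * PI + 2 * Re (eith kappa * base_log kappa kappa))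
    by (unfold A; field; lra).
  assert (H3 : S * Im (base_log kappa x) <= PI) by nra. lra.
Qed.

(** [height] grows continuously from [0] at [kappa] to infinity, so the real points
    to the right of [kappa] already cover the spiral. *)
Lemma spiral_real kappa t : admissible kappa -> 0 <= t ->
  exists x : R, k kappa x = spiral kappa t.
Proof.
  intros Ha Ht. destruct (height_unbounded kappa t Ha) as [b [Hb1 Hb2]].
  destruct (IVT_gen (height kappa) kappa b t (height_continuity kappa Ha)) as [x [_ Hx]].
  - rewrite height_kappa, Rmin_left, Rmax_right; lra.
  - exists x. rewrite k_real, Hx by exact Ha. reflexivity.
Qed.

Lemma k_real_S1 kappa (x : R) : admissible kappa -> S1 kappa (k kappa x).
Proof.
  intros Ha. exists (height kappa x). split; [|now apply k_real].
  destruct (Req_dec x kappa) as [->|H]; [rewrite height_kappa; lra|].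
  left. now apply height_pos.
Qed.

Lemma k_real_eq_1 kappa (x : R) : admissible kappa -> k kappa x = 1 -> x = kappa.
Proof.
  intros Ha. rewrite k_real by exact Ha. intros H.
  destruct (Req_dec x kappa) as [E|E]; [exact E|].
  assert (Hp := height_pos kappa x Ha E). assert (Hc := cos_theta_pos kappa Ha).
  apply (f_equal Cmod) in H. rewrite Cmod_Cexp, Cmod_1, <- exp_0 in H.
  apply exp_inv in H. rewrite re_scal_l, eith_eq in H. unfold Re in H; simpl in H. nra.
Qed.

(** [|k z|] is comparable to [|z|] raised to [1 + cos (2 theta) = 2 cos(theta)^2], a
    positive exponent; the argument of [z - conj beta] contributes a bounded factor. *)
Lemma k_growth kappa M : admissible kappa -> exists r, 0 < r /\
  forall z, 0 <= Im z -> r < Cmod z -> M < Cmod (k kappa z).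
Proof.
  intros Ha. assert (Hc := cos_theta_pos kappa Ha).
  assert (HN := k_num_kappa_neq_0 kappa Ha).
  set (N := Cmod (k_num kappa kappa)). assert (HN' : 0 < N) by (now apply Cmod_gt_0).
  set (D := cos (theta kappa)) in *. set (S := sin (theta kappa)) in *.
  (* For [m > exp A], the lower bound [exp (2 D^2 ln m - PI) / 2] exceeds [M N]. *)
  set (A := (ln (2 * (Rabs M + 1) * N) + PI) / (2 * D ^ 2)).
  assert (HM := Rabs_pos M). assert (HM' := Rle_abs M).
  assert (HSD : S * S + D * D = 1) by apply sin2_cos2.
  exists (exp A + 8 + Cmod (beta kappa)).
  assert (HA := exp_pos A). assert (Hb := Cmod_ge_0 (beta kappa)).
  split; [lra|]. intros z Hz Hr.
  assert (Hz' := nonneg_above kappa z Ha Hz).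
  set (m := Cmod (z - Cconj (beta kappa))).
  assert (Hm : exp A + 8 <= m).
  { assert (H := Cmod_sub_le z (Cconj (beta kappa))). rewrite Cmod_conj in H.
    fold m in H. lra. }
  assert (Hbb : Cmod (beta kappa - Cconj (beta kappa)) <= 4).
  { rewrite beta_diff, !Cmod_mult, Cmod_Ci, !Cmod_R. fold D.
    rewrite (Rabs_pos_eq 2), (Rabs_pos_eq (2 * D)) by lra.
    assert (H := COS_bound (theta kappa)). fold D in H. lra. }
  assert (Hzb : m / 2 <= Cmod (z - beta kappa)).
  { assert (H := Cmod_sub_triangle z (beta kappa) (Cconj (beta kappa))).
    fold m in H. lra. }
  unfold k. rewrite Cmod_div by exact HN. fold N. rewrite (k_num_eq kappa z), Cmod_mult, Cmod_Cexp.
  apply Rlt_div_r; [exact HN'|].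
  assert (Hi := Im_Clog_bounds (z - Cconj (beta kappa))). fold (base_log kappa z) in Hi.
  assert (HE : (2 * D ^ 2 - 1) * ln m - PI
    <= Re (eith kappa * eith kappa * base_log kappa z)).
  { rewrite re_mult, re_mult, im_mult, eith_eq.
    replace (Re (base_log kappa z)) with (ln m) by reflexivity.
    unfold Re, Im at 1 2 3 4; simpl fst; simpl snd. fold S. fold D.
    replace (D * D - S * S) with (2 * D ^ 2 - 1) by nra.
    assert ((D * S + S * D) * Im (base_log kappa z) <= PI); [|lra].
    assert (D * S + S * D <= 1) by (assert (0 <= (D - S) ^ 2) by apply pow2_ge_0; nra).
    nra. }
  assert (Hln : A < ln m).
  { rewrite <- (ln_exp A). apply ln_increasing; lra. }
  apply Rlt_le_trans with (m / 2 * exp ((2 * D ^ 2 - 1) * ln m - PI)).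
  2:{ apply Rmult_le_compat; [lra|left; apply exp_pos|exact Hzb|].
      destruct HE as [HE|HE]; [left; now apply exp_increasing|right; now f_equal]. }
  replace (m / 2) with (exp (ln m) / 2) by (rewrite exp_ln; lra).
  replace (exp (ln m) / 2 * exp ((2 * D ^ 2 - 1) * ln m - PI))
    with (exp (2 * D ^ 2 * ln m - PI) / 2).
  2:{ replace (2 * D ^ 2 * ln m - PI) with (ln m + ((2 * D ^ 2 - 1) * ln m - PI)) by ring.
      rewrite exp_plus. field. }
  assert (HQ : 0 < 2 * (Rabs M + 1) * N) by (repeat apply Rmult_lt_0_compat; lra).
  assert (H : 2 * (Rabs M + 1) * N < exp (2 * D ^ 2 * ln m - PI)).
  { rewrite <- (exp_ln _ HQ) at 1. apply exp_increasing.
    assert (H1 : 2 * D ^ 2 * A = ln (2 * (Rabs M + 1) * N) + PI) by (unfold A; field; lra).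
    assert (H2 : 2 * D ^ 2 * A < 2 * D ^ 2 * ln m) by (apply Rmult_lt_compat_l; nra).
    lra. }
  nra.
Qed.

(** * Univalence of k *)

(** In the disc coordinate [zeta = exp s = (z - beta) / (z - conj beta)], the
    function [spiral_log] is [log k / eith] up to a constant, and [half_plane_of] is
    [z - conj beta]. *)
Definition half_plane_of (kappa : R) (s : C) : C :=
  ((beta kappa - Cconj (beta kappa)) * / (1 - Cexp s))%C.

Definition spiral_log (kappa : R) (s : C) : C :=
  (/ eith kappa * s + RtoC (2 * cos (theta kappa)) * Clog (half_plane_of kappa s))%C.

Definition left_half (s : C) : Prop := Re s <= 0 /\ Cexp s <> 1.

Lemma left_half_Re s : left_half s -> Re (Cexp s) < 1.
Proof.
  intros [H1 H2].
  assert (Hm : Cmod (Cexp s) <= 1).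
  { rewrite Cmod_Cexp, <- exp_0. destruct H1 as [H1|H1].
    - left. now apply exp_increasing.
    - rewrite H1. lra. }
  assert (Hm2 : Cmod (Cexp s) ^ 2 <= 1).
  { assert (H := Cmod_ge_0 (Cexp s)). nra. }
  rewrite Cmod2_alt in Hm2.
  destruct (Rlt_or_le (Re (Cexp s)) 1) as [H|H]; [exact H|].
  elim H2. destruct (Cexp s) as [x y]. unfold Re, Im, RtoC in *; simpl in *.
  assert (x = 1) by nra. subst x. assert (y = 0) by nra. now subst.
Qed.

Lemma Re_inv_pos z : 0 < Re z -> 0 < Re (/ z).
Proof.
  destruct z as [x y]. unfold Re, Cinv; simpl. intros H.
  apply Rdiv_lt_0_compat; nra.
Qed.

Lemma UH_half_plane_of kappa s : admissible kappa -> left_half s -> UH (half_plane_of kappa s).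
Proof.
  intros Ha Hs. assert (Hc := cos_theta_pos kappa Ha). apply left_half_Re in Hs.
  unfold half_plane_of. rewrite beta_diff.
  assert (H := Re_inv_pos (1 - Cexp s)).
  destruct (/ (1 - Cexp s))%C as [x y]. unfold UH, Im, Re, Ci, RtoC, Cmult in *; simpl in *.
  assert (0 < 2 * cos (theta kappa) * x); [apply Rmult_lt_0_compat; [lra|]; apply H|]; lra.
Qed.

Lemma left_half_neq s : left_half s -> (1 - Cexp s)%C <> 0.
Proof. intros [_ H] E. apply H. symmetry. now apply Ceq_minus. Qed.

Lemma cdiff_spiral_log kappa s : admissible kappa -> left_half s ->
  cdiff left_half (spiral_log kappa) s
    (/ eith kappa + RtoC (2 * cos (theta kappa)) * (Cexp s / (1 - Cexp s)))%C.
Proof.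
  intros Ha Hs. assert (He := eith_neq_0 kappa). assert (Hn := left_half_neq s Hs).
  assert (Hb : (beta kappa - Cconj (beta kappa))%C <> 0).
  { apply above_sub_neq_0. apply nonneg_above; [exact Ha|].
    apply Rlt_le, UH_beta, Ha. }
  eapply cdiff_eq.
  - unfold spiral_log. apply cdiff_plus; [apply cdiff_scal, cdiff_id|].
    apply cdiff_scal.
    apply (cdiff_comp left_half UH (half_plane_of kappa) Clog).
    + unfold half_plane_of. apply cdiff_scal.
      apply (cdiff_inv left_half (fun w => 1 - Cexp w)%C); [|exact Hn|].
      * apply cdiff_plus; [apply cdiff_const|].
        apply (cdiff_ext left_half (fun w => - (1) * Cexp w)%C); [exact Hs| |].
        { intros; ring. }
        apply cdiff_scal. apply (cdiff_subset _ total); [easy|]. apply cdiff_Cexp.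
      * intros w Hw. now apply left_half_neq.
    + apply cdiff_Clog. now apply UH_half_plane_of.
    + intros w Hw. now apply UH_half_plane_of.
  - unfold half_plane_of. field. repeat split; assumption.
Qed.

(** [1 / eith + 2 cos theta * zeta / (1 - zeta)] has the real part of
    [cos theta * (1 + zeta) / (1 - zeta)]. *)
Lemma Re_deriv_spiral_log_pos kappa s : admissible kappa -> Re s < 0 ->
  0 < Re (/ eith kappa + RtoC (2 * cos (theta kappa)) * (Cexp s / (1 - Cexp s))).
Proof.
  intros Ha Hs. assert (Hc := cos_theta_pos kappa Ha).
  assert (Hm : Cmod (Cexp s) < 1).
  { rewrite Cmod_Cexp, <- exp_0. now apply exp_increasing. }
  assert (Hm2 : Cmod (Cexp s) ^ 2 < 1).
  { assert (H := Cmod_ge_0 (Cexp s)). nra. }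
  rewrite Cmod2_alt in Hm2.
  rewrite <- Cconj_eith, eith_eq, re_plus, re_scal_l.
  destruct (Cexp s) as [x y]. unfold Re, Im, Cdiv, Cinv, Cmult, Cminus, Cplus, Copp, Cconj, RtoC in *.
  simpl in *. set (D := cos (theta kappa)) in *.
  assert (Hx : x < 1) by nra.
  set (m := (1 + - x) * ((1 + - x) * 1) + (0 + - y) * ((0 + - y) * 1)).
  assert (Hmp : 0 < m) by (unfold m; nra).
  replace (_ + _) with (D * (1 - x * x - y * y) / m) by (unfold m; field; unfold m in Hmp; lra).
  apply Rdiv_lt_0_compat; [|exact Hmp]. apply Rmult_lt_0_compat; nra.
Qed.

(** Noshiro--Warschawski: on a segment, a derivative with positive real part moves
    the function in the direction of the segment; only interior points matter, so
    one end may lie on the boundary line. *)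
Lemma spiral_log_injective kappa s1 s2 : admissible kappa -> Re s1 < 0 -> left_half s2 ->
  spiral_log kappa s1 = spiral_log kappa s2 -> s1 = s2.
Proof.
  intros Ha H1 H2 E. destruct (classic (s1 = s2)) as [H|Hne]; [exact H|exfalso].
  assert (Hd : (s2 - s1)%C <> 0) by (apply Cminus_eq_contra; auto).
  set (d := (s2 - s1)%C) in *.
  set (dS := fun s => (/ eith kappa
    + RtoC (2 * cos (theta kappa)) * (Cexp s / (1 - Cexp s)))%C).
  set (seg := fun w => (s1 + w * d)%C).
  assert (Hre : forall r : R, Re (seg r) = Re s1 + r * (Re s2 - Re s1)).
  { intros r. unfold seg, d. rewrite re_plus, re_scal_l. unfold Cminus.
    rewrite re_plus, re_opp. ring. }
  assert (Hin : forall r, 0 <= r < 1 -> Re (seg r) < 0).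
  { intros r Hr. rewrite Hre. destruct H2 as [H2 _]. nra. }
  assert (Hseg : forall w, reals (fun r => 0 <= r <= 1) w -> left_half (seg w)).
  { intros w Hw. rewrite (reals_eq _ _ Hw). destruct Hw as [_ [Hw0 [Hw1|Hw1]]].
    - assert (H := Hin (Re w) (conj Hw0 Hw1)). split; [lra|].
      intros H3. apply (f_equal Cmod) in H3. rewrite Cmod_Cexp, Cmod_1, <- exp_0 in H3.
      apply exp_inv in H3. lra.
    - rewrite Hw1. replace (seg 1) with s2 by (unfold seg, d; ring). exact H2. }
  destruct (curve_MVT (fun w => spiral_log kappa (seg w)) (fun r => (dS (seg r) * d)%C)
    0 1 (Cconj d)) as [xi [Hxi EE]]; [lra| |].
  - intros r Hr. apply (cdiff_comp _ left_half seg (spiral_log kappa)); [| |exact Hseg].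
    + unfold seg. eapply cdiff_eq.
      * apply cdiff_plus; [apply cdiff_const|].
        apply cdiff_mult; [apply cdiff_id|apply cdiff_const].
      * cbv beta; ring.
    + apply cdiff_spiral_log; [exact Ha|]. apply Hseg.
      split; [apply im_RtoC|]. now rewrite re_RtoC.
  - replace (seg 1) with s2 in EE by (unfold seg, d; ring).
    replace (seg 0) with s1 in EE by (unfold seg; ring).
    rewrite E in EE.
    replace (Cconj d * (spiral_log kappa s2 - spiral_log kappa s2))%C
      with (RtoC 0) in EE by ring.
    assert (HP := Re_deriv_spiral_log_pos kappa (seg xi) Ha (Hin xi ltac:(lra))).
    fold (dS (seg xi)) in HP.
    replace (Cconj d * (dS (seg xi) * d))%C with (RtoC (Cmod d ^ 2) * dS (seg xi))%C in EE.
    2:{ rewrite Cmod2_conj. ring. }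
    rewrite re_scal_l, re_RtoC in EE.
    assert (HP2 : 0 < Cmod d ^ 2) by (apply pow_lt; now apply Cmod_gt_0).
    assert (0 < Cmod d ^ 2 * Re (dS (seg xi))) by (now apply Rmult_lt_0_compat). lra.
Qed.

Lemma Cmod_lt_sqr a b : Cmod a ^ 2 < Cmod b ^ 2 -> Cmod a < Cmod b.
Proof.
  intros H. assert (H1 := Cmod_ge_0 a). assert (H2 := Cmod_ge_0 b). nra.
Qed.

Lemma dist_beta kappa z :
  Cmod (z - Cconj (beta kappa)) ^ 2 - Cmod (z - beta kappa) ^ 2
  = 8 * cos (theta kappa) * Im z.
Proof.
  rewrite !Cmod2_alt, beta_eq. destruct z as [x y].
  unfold Re, Im, Cminus, Cplus, Copp, Cconj; simpl. ring.
Qed.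

(** The relation [z - beta = exp s * (z - conj beta)] turns [k_num] into
    [exp (s + (1 + eith^2) log (z - conj beta))], and [1 + eith^2 = 2 cos theta * eith]. *)
Lemma k_spiral_log kappa z : admissible kappa -> 0 <= Im z -> z <> beta kappa ->
  exists s, left_half s /\ (UH z -> Re s < 0) /\
    (z = Cconj (beta kappa) + half_plane_of kappa s)%C /\
    k_num kappa z = Cexp (eith kappa * spiral_log kappa s).
Proof.
  intros Ha Hz Hne. assert (Hz' := nonneg_above kappa z Ha Hz).
  assert (Hn := above_sub_neq_0 kappa z Hz').
  assert (Hn' := Cminus_eq_contra _ _ Hne).
  assert (Hc := cos_theta_pos kappa Ha).
  assert (Hdiff : (beta kappa - Cconj (beta kappa))%C <> 0).
  { apply above_sub_neq_0. apply nonneg_above; [exact Ha|].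
    apply Rlt_le, UH_beta, Ha. }
  assert (HD := dist_beta kappa z).
  set (zeta := ((z - beta kappa) / (z - Cconj (beta kappa)))%C).
  assert (Hzeta : zeta <> 0).
  { unfold zeta. apply Cmult_neq_0; [exact Hn'|]. apply Cmod_gt_0.
    rewrite Cmod_inv by exact Hn. now apply Rinv_0_lt_compat, Cmod_gt_0. }
  destruct (Cexp_surjective zeta Hzeta) as [s Hs].
  assert (Hmod : exp (Re s) = Cmod (z - beta kappa) / Cmod (z - Cconj (beta kappa))).
  { rewrite <- Cmod_Cexp, Hs. unfold zeta. now apply Cmod_div. }
  assert (Hpos : 0 < Cmod (z - Cconj (beta kappa))) by (now apply Cmod_gt_0).
  assert (H1z : (1 - zeta)%C <> 0).
  { replace (1 - zeta)%C
      with ((beta kappa - Cconj (beta kappa)) / (z - Cconj (beta kappa)))%C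
      by (unfold zeta; field; exact Hn).
    apply Cmod_gt_0. rewrite Cmod_div by exact Hn.
    apply Rdiv_lt_0_compat; [now apply Cmod_gt_0|exact Hpos]. }
  assert (Hhp : half_plane_of kappa s = (z - Cconj (beta kappa))%C).
  { unfold half_plane_of. rewrite Hs.
    replace (1 - zeta)%C
      with ((beta kappa - Cconj (beta kappa)) / (z - Cconj (beta kappa)))%C
      by (unfold zeta; field; exact Hn).
    field. split; assumption. }
  exists s. split; [split|split; [|split]].
  - apply Rnot_lt_le. intros H. apply exp_increasing in H. rewrite exp_0, Hmod in H.
    apply Rlt_div_r in H; [|exact Hpos]. rewrite Rmult_1_l in H.
    assert (H2 : Cmod (z - Cconj (beta kappa)) ^ 2 < Cmod (z - beta kappa) ^ 2) by nra.
    assert (0 <= 8 * cos (theta kappa) * Im z) by (repeat apply Rmult_le_pos; lra). lra.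
  - rewrite Hs. intros E. apply H1z. rewrite E. ring.
  - intros Hu. apply exp_lt_inv. rewrite exp_0, Hmod.
    apply Rlt_div_l; [exact Hpos|]. rewrite Rmult_1_l. apply Cmod_lt_sqr.
    assert (0 < 8 * cos (theta kappa) * Im z) by (repeat apply Rmult_lt_0_compat; lra || exact Hu).
    lra.
  - rewrite Hhp. ring.
  - rewrite (k_num_eq kappa z).
    replace (z - beta kappa)%C with (zeta * (z - Cconj (beta kappa)))%C
      by (unfold zeta; field; exact Hn).
    rewrite <- Hs. rewrite <- (Cexp_Clog (z - Cconj (beta kappa))) by (now apply above_UH).
    fold (base_log kappa z). rewrite <- !Cexp_plus. f_equal.
    unfold spiral_log. rewrite Hhp. fold (base_log kappa z). rewrite eith_sum.
    field. apply eith_neq_0.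
Qed.

Lemma k_eq_0 kappa z : admissible kappa -> k kappa z = 0 -> z = beta kappa.
Proof.
  intros Ha H. destruct (classic (z = beta kappa)) as [E|E]; [exact E|exfalso].
  revert H. unfold k, Cdiv. rewrite (k_num_eq kappa z).
  apply Cmult_neq_0; [apply Cmult_neq_0|].
  - now apply Cminus_eq_contra.
  - apply Cexp_neq_0.
  - apply Cmod_gt_0. rewrite Cmod_inv by (now apply k_num_kappa_neq_0).
    now apply Rinv_0_lt_compat, Cmod_gt_0, k_num_kappa_neq_0.
Qed.

(** Equal values of [k] give equal values of [spiral_log] after a shift of one
    argument by a multiple of [2 i pi], which does not change the point. *)
Lemma k_injective kappa z1 z2 : admissible kappa -> UH z1 -> 0 <= Im z2 ->
  k kappa z1 = k kappa z2 -> z1 = z2.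
Proof.
  intros Ha H1 H2 E.
  assert (HN := k_num_kappa_neq_0 kappa Ha).
  destruct (classic (z1 = beta kappa)) as [E1|N1].
  { rewrite E1, k_beta in E by exact Ha. symmetry in E.
    apply k_eq_0 in E; [|exact Ha]. congruence. }
  destruct (classic (z2 = beta kappa)) as [E2|N2].
  { rewrite E2, k_beta in E by exact Ha. apply k_eq_0 in E; [|exact Ha]. congruence. }
  destruct (k_spiral_log kappa z1 Ha (Rlt_le _ _ H1) N1) as [s1 [_ [L1 [Z1 K1]]]].
  destruct (k_spiral_log kappa z2 Ha H2 N2) as [s2 [L2 [_ [Z2 K2]]]].
  assert (Ek : k_num kappa z1 = k_num kappa z2).
  { replace (k_num kappa z1) with (k kappa z1 * k_num kappa kappa)%C
      by (unfold k; field; exact HN).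
    rewrite E. unfold k; field; exact HN. }
  rewrite K1, K2 in Ek. destruct (Cexp_inj_mod _ _ Ek) as [n Hn].
  set (t := (2 * Ci * RtoC (IZR n * PI))%C) in *.
  assert (Hexp : Cexp (s2 + t) = Cexp s2).
  { rewrite Cexp_plus. unfold t. rewrite Cexp_2PI. ring. }
  assert (Hhp : half_plane_of kappa (s2 + t) = half_plane_of kappa s2).
  { unfold half_plane_of. now rewrite Hexp. }
  rewrite Z1, Z2. f_equal. rewrite <- Hhp. f_equal.
  apply (spiral_log_injective kappa); [exact Ha|auto| |].
  - destruct L2 as [L2 L2']. split; [|now rewrite Hexp].
    replace (Re (s2 + t)) with (Re s2); [exact L2|].
    rewrite re_plus. unfold t, Re, Ci, RtoC, Cmult; simpl. ring.
  - unfold spiral_log at 2. rewrite Hhp.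
    assert (He := eith_neq_0 kappa).
    replace (spiral_log kappa s1)
      with (/ eith kappa * (eith kappa * spiral_log kappa s1))%C by (field; exact He).
    rewrite Hn. unfold spiral_log. field. exact He.
Qed.

(** Points of [S1] are values of [k] on the real line, and [k] takes no value both on
    the real line and in the half-plane. *)
Lemma k_not_S1 kappa z : admissible kappa -> UH z -> ~ S1 kappa (k kappa z).
Proof.
  intros Ha Hz [t [Ht E]]. destruct (spiral_real kappa t Ha Ht) as [x Hx].
  apply (UH_neq_real z x Hz). apply (k_injective kappa); [exact Ha|exact Hz| |congruence].
  rewrite im_RtoC. lra.
Qed.

(** * The image of k and its inverse *)

(** Growth at infinity makes the closed half-plane behave like a compact set. *)
Lemma k_gap kappa (P : C -> Prop) w : admissible kappa ->
  (forall z, ~ P z -> exists del, 0 < del /\ forall v, Cmod (v - z) < del -> ~ P v) ->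
  (forall z, 0 <= Im z -> P z -> k kappa z <> w) ->
  exists eps, 0 < eps /\ forall z, 0 <= Im z -> P z -> eps <= Cmod (k kappa z - w).
Proof.
  intros Ha HP Hw. destruct (k_growth kappa (Cmod w + 1) Ha) as [r [Hr Hg]].
  destruct (compact_positive (fun z => 0 <= Im z /\ P z /\ Cmod z <= r)
    (fun z => Cmod (k kappa z - w)) r) as [eps [He H]].
  - intros z [_ [_ H]]; exact H.
  - intros z. destruct (Rlt_or_le (Im z) 0) as [Hz|Hz].
    { exists (- Im z). split; [lra|]. intros v [Hv _] Hd. exfalso.
      assert (H := Im_le_Cmod (v - z)). unfold Cminus in H at 1.
      rewrite im_plus, im_opp in H. assert (H1 := Rle_abs (Im v + - Im z)). lra. }
    destruct (classic (P z)) as [Hp|Hp].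
    + assert (Hn : 0 < Cmod (k kappa z - w))
        by (apply Cmod_gt_0, Cminus_eq_contra; auto).
      destruct (cdiff_ccont _ _ _ _ (cdiff_k kappa z Ha (nonneg_above kappa z Ha Hz))
        (Cmod (k kappa z - w) / 2)) as [d [Hd H]]; [lra|].
      exists (Rmin d (Cmod (k kappa z - w) / 2)). split; [apply Rmin_pos; lra|].
      intros v [Hv [_ _]] Hvd.
      specialize (H v (nonneg_above kappa v Ha Hv) (Rlt_le_trans _ _ _ Hvd (Rmin_l _ _))).
      assert (H1 := Cmod_sub_triangle (k kappa z) (k kappa v) w).
      rewrite (Cmod_sub_sym (k kappa z) (k kappa v)) in H1.
      assert (H2 := Rmin_r d (Cmod (k kappa z - w) / 2)). lra.
    + destruct (HP z Hp) as [d [Hd H]]. exists d. split; [exact Hd|].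
      intros v [_ [Hv _]] Hvd. now elim (H v Hvd).
  - exists (Rmin eps 1). split; [apply Rmin_pos; lra|]. intros z Hz Hp.
    destruct (Rle_or_lt (Cmod z) r) as [Hzr|Hzr].
    + apply Rle_trans with (1 := Rmin_l _ _). now apply H.
    + apply Rle_trans with (1 := Rmin_r _ _). specialize (Hg z Hz Hzr).
      assert (H1 := Cmod_sub_le (k kappa z) w). lra.
Qed.

(** Continuity of the inverse of [k], up to the boundary, at values taken only once:
    it serves at interior points, at the starting point [kappa] and at [beta]. *)
Lemma k_near kappa z0 : admissible kappa ->
  (forall z, 0 <= Im z -> k kappa z = k kappa z0 -> z = z0) ->
  forall eps, 0 < eps -> exists del, 0 < del /\ forall z, 0 <= Im z ->
    Cmod (k kappa z - k kappa z0) < del -> Cmod (z - z0) < eps.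
Proof.
  intros Ha Hu eps He.
  destruct (k_gap kappa (fun z => eps <= Cmod (z - z0)) (k kappa z0) Ha)
    as [d [Hd H]].
  - intros z Hz. exists (eps - Cmod (z - z0)). split; [lra|]. intros v Hv.
    assert (H := Cmod_sub_triangle v z z0). lra.
  - intros z Hz Hz' E. apply (Hu z Hz) in E. subst z.
    replace (z0 - z0)%C with (RtoC 0) in Hz' by ring. rewrite Cmod_0 in Hz'. lra.
  - exists d. split; [exact Hd|]. intros z Hz Hk.
    apply Rnot_le_lt. intros H1. specialize (H z Hz H1). lra.
Qed.

Lemma k_open kappa z0 : admissible kappa -> UH z0 -> exists del, 0 < del /\
  forall w, Cmod (w - k kappa z0) < del -> exists z, UH z /\ k kappa z = w.
Proof.
  intros Ha Hz0.
  assert (HD : forall z, disc z0 (Im z0) z -> UH z).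
  { intros z. apply near_UH. }
  assert (HA : forall z, disc z0 (Im z0) z -> above kappa z).
  { intros z Hz. apply nonneg_above; [exact Ha|]. now apply Rlt_le, HD. }
  destruct (open_mapping (k kappa) (dk kappa) z0 (Im z0) Hz0) as [d [Hd H]].
  - intros z Hz. apply (cdiff_subset _ (above kappa)); [exact HA|].
    apply cdiff_k; auto.
  - intros z Hz. apply dk_neq_0; auto. apply UH_neq_real; auto.
  - exists d. split; [exact Hd|]. intros w Hw. destruct (H w Hw) as [z [Hz E]].
    exists z. auto.
Qed.

Lemma S1_spiral_mult kappa w tau : 0 <= tau ->
  S1 kappa (w * Cexp (- (RtoC tau * eith kappa))) -> S1 kappa w.
Proof.
  intros Ht [t [Ht' E]]. exists (t + tau). split; [lra|].
  unfold spiral in *. rewrite RtoC_plus, Cmult_plus_distr_r, Cexp_plus, <- E, <- Cmult_assoc.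
  rewrite <- Cexp_plus. replace (- (tau * eith kappa) + tau * eith kappa)%C with (RtoC 0) by ring.
  rewrite Cexp_0. ring.
Qed.

(** The spiral through [w] leads to [0 = k (beta)] without meeting [S1].  On it,
    being a value of [k] on the half-plane is an open condition, and so is the
    opposite: a limit of values that is not a value would be taken on the real
    line, hence lie on [S1]. *)
Lemma k_surjective kappa w : admissible kappa -> ~ S1 kappa w -> exists z, UH z /\ k kappa z = w.
Proof.
  intros Ha Hw. assert (Hc := cos_theta_pos kappa Ha).
  set (p := fun v => (w * Cexp (- (v * eith kappa)))%C).
  set (E := fun tau : R => exists z, UH z /\ k kappa z = p tau).
  assert (Hp0 : p 0 = w).
  { unfold p. replace (- (0 * eith kappa))%C with (RtoC 0) by ring. rewrite Cexp_0. ring. }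
  assert (Hpc : forall v, ccont total p v).
  { intros v. unfold p. apply ccont_mult; [apply ccont_const|].
    apply (ccont_comp total total (fun u => - (u * eith kappa))%C Cexp); [| |easy].
    - apply (ccont_ext total (fun u => - (1) * u * eith kappa)%C); [exact I| |].
      { intros; ring. }
      apply ccont_mult; [apply ccont_mult|]; auto using ccont_const, ccont_id.
    - eapply cdiff_ccont, cdiff_Cexp. }
  destruct (k_open kappa (beta kappa) Ha (UH_beta kappa Ha)) as [d0 [Hd0 H0]].
  rewrite k_beta in H0 by exact Ha.
  assert (Hw0 := Cmod_ge_0 w).
  (* Large enough for [|p T| = |w| exp (- T cos theta)] to be below [d0]. *)
  set (T := Cmod w / (d0 * cos (theta kappa))).
  assert (HT : 0 <= T).
  { apply Rmult_le_pos; [exact Hw0|]. left. apply Rinv_0_lt_compat. nra. }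
  assert (HET : E T).
  { apply H0. replace (p T - 0)%C with (p T) by ring. unfold p.
    rewrite Cmod_mult, Cmod_Cexp, re_opp, re_scal_l, eith_eq.
    unfold Re; simpl fst. rewrite exp_Ropp. fold (Rdiv (Cmod w) (exp (T * cos (theta kappa)))).
    apply Rlt_div_l; [apply exp_pos|].
    assert (H1 := exp_ineq1_le (T * cos (theta kappa))).
    apply Rlt_le_trans with (d0 * (1 + T * cos (theta kappa))).
    - replace (d0 * (1 + T * cos (theta kappa))) with (d0 + Cmod w)
        by (unfold T; field; lra). lra.
    - apply Rmult_le_compat_l; lra. }
  assert (HE : E (T - T)).
  2:{ destruct HE as [z [Hz Ez]]. exists z. split; [exact Hz|].
      rewrite Ez, Rminus_diag. exact Hp0. }
  apply (real_induction (fun r => E (T - r)) T); [| |lra].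
  - intros s Hs [z [Hz Ez]].
    destruct (k_open kappa z Ha Hz) as [d [Hd H]]. rewrite Ez in H.
    destruct (Hpc (RtoC (T - s)) d Hd) as [d' [Hd' H']].
    exists d'. split; [exact Hd'|]. intros r Hr Hrs.
    apply H, H'; [exact I|]. rewrite Cmod_RtoC_sub.
    replace (T - r - (T - s)) with (- (r - s)) by ring. now rewrite Rabs_Ropp.
  - intros s Hs Hlow. apply NNPP. intros HEs.
    destruct (proj1 Hs) as [Hs0|Hs0].
    2:{ apply HEs. rewrite <- Hs0, Rminus_0_r. exact HET. }
    destruct (k_gap kappa (fun _ => True) (p (RtoC (T - s))) Ha) as [d [Hd H]].
    + intros z Hz. now elim Hz.
    + intros z [Hz|Hz] _ Ez; [apply HEs; now exists z|].
      apply Hw. apply (S1_spiral_mult kappa w (T - s)); [lra|].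
      fold (p (RtoC (T - s))). rewrite <- Ez.
      replace z with (RtoC (Re z)); [now apply k_real_S1|].
      apply injective_projections; [reflexivity|]. exact Hz.
    + destruct (Hpc (RtoC (T - s)) d Hd) as [d' [Hd' H']].
      assert (Hl := Rmin_l (d' / 2) s). assert (Hr := Rmin_r (d' / 2) s).
      assert (Hmin : 0 < Rmin (d' / 2) s) by (apply Rmin_pos; lra).
      destruct (Hlow (s - Rmin (d' / 2) s)) as [z [Hz Ez]]; [lra|].
      specialize (H z (Rlt_le _ _ Hz) I). rewrite Ez in H.
      assert (H1 := H' (RtoC (T - (s - Rmin (d' / 2) s))) I).
      rewrite Cmod_RtoC_sub, Rabs_pos_eq in H1; [|lra]. specialize (H1 ltac:(lra)). lra.
Qed.

Lemma k_inv_spec kappa w : admissible kappa -> ~ S1 kappa w ->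
  UH (k_inv kappa w) /\ k kappa (k_inv kappa w) = w.
Proof.
  intros Ha Hw. unfold k_inv.
  apply (epsilon_spec (inhabits (RtoC 0)) (fun z => UH z /\ k kappa z = w)).
  now apply k_surjective.
Qed.

Lemma k_inv_eq kappa z w : admissible kappa -> UH z -> k kappa z = w -> k_inv kappa w = z.
Proof.
  intros Ha Hz <-. destruct (k_inv_spec kappa (k kappa z) Ha (k_not_S1 kappa z Ha Hz)) as [H E].
  apply (k_injective kappa); auto. now apply Rlt_le.
Qed.

Lemma not_S1_open kappa w : admissible kappa -> ~ S1 kappa w ->
  exists del, 0 < del /\ forall v, Cmod (v - w) < del -> ~ S1 kappa v.
Proof.
  intros Ha Hw. destruct (k_surjective kappa w Ha Hw) as [z [Hz <-]].
  destruct (k_open kappa z Ha Hz) as [d [Hd H]]. exists d. split; [exact Hd|].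
  intros v Hv. destruct (H v Hv) as [u [Hu <-]]. now apply k_not_S1.
Qed.

Lemma k_inv_continuous kappa w : admissible kappa -> ~ S1 kappa w ->
  ccont (fun v => ~ S1 kappa v) (k_inv kappa) w.
Proof.
  intros Ha Hw eps He. destruct (k_inv_spec kappa w Ha Hw) as [Hz Ez].
  destruct (k_near kappa (k_inv kappa w) Ha) with (eps := eps) as [d [Hd H]]; [|exact He|].
  - intros z Hz' E. symmetry. now apply (k_injective kappa).
  - exists d. split; [exact Hd|]. intros v Hv Hvw.
    destruct (k_inv_spec kappa v Ha Hv) as [Hu Eu].
    apply H; [now apply Rlt_le|]. now rewrite Eu, Ez.
Qed.

Lemma cdiff_k_inv kappa w : admissible kappa -> ~ S1 kappa w ->
  cdiff total (k_inv kappa) w (/ dk kappa (k_inv kappa w))%C.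
Proof.
  intros Ha Hw. destruct (k_inv_spec kappa w Ha Hw) as [Hz Ez].
  destruct (not_S1_open kappa w Ha Hw) as [d [Hd H]].
  apply (cdiff_local (fun v => ~ S1 kappa v) total _ _ _ d Hd); [auto|].
  assert (Hab := nonneg_above kappa _ Ha (Rlt_le _ _ Hz)).
  apply (cdiff_inverse (above kappa) _ (k kappa)).
  - intros v Hv. apply nonneg_above; [exact Ha|]. now apply Rlt_le, k_inv_spec.
  - intros v Hv. now apply k_inv_spec.
  - exact Ez.
  - now apply k_inv_continuous.
  - now apply cdiff_k.
  - apply dk_neq_0; auto. now apply UH_neq_real.
Qed.

Lemma k_conformal kappa : admissible kappa ->
  conformal_onto UH (fun w => ~ S1 kappa w) (k kappa).
Proof.
  intros Ha. split; [|split; [|split]].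
  - intros z Hz. exists (dk kappa z). apply cdiff_is_derive.
    apply (cdiff_local (above kappa) total _ _ _ (Im z) Hz).
    + intros w _ Hw. apply nonneg_above; [exact Ha|]. apply Rlt_le, (near_UH z), Hw.
    + apply cdiff_k; [exact Ha|]. apply nonneg_above; [exact Ha|]. now apply Rlt_le.
  - intros z Hz. now apply k_not_S1.
  - intros z v Hz Hv E. apply (k_injective kappa); auto. now apply Rlt_le.
  - intros w Hw. now apply k_surjective.
Qed.

(** * The Loewner flow *)

(** The time change under which the flow moves [k] along spirals at unit speed. *)
Definition clock (kappa t : R) : R := - (cos (theta kappa) * ln (1 - t)).

Lemma spiral_plus kappa a b : spiral kappa (a + b) = (spiral kappa a * spiral kappa b)%C.
Proof. unfold spiral. rewrite RtoC_plus, Cmult_plus_distr_r. apply Cexp_plus. Qed.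

Lemma spiral_0 kappa : spiral kappa 0 = 1.
Proof.
  unfold spiral. replace (RtoC 0 * eith kappa)%C with (RtoC 0) by ring. apply Cexp_0.
Qed.

Lemma Cmod_spiral kappa t : Cmod (spiral kappa t) = exp (t * cos (theta kappa)).
Proof. unfold spiral. rewrite Cmod_Cexp, re_scal_l, eith_eq. reflexivity. Qed.

Lemma spiral_inj kappa a b : admissible kappa -> spiral kappa a = spiral kappa b -> a = b.
Proof.
  intros Ha E. apply cos_theta_pos in Ha. apply (f_equal Cmod) in E.
  rewrite !Cmod_spiral in E. apply exp_inv in E. nra.
Qed.

Lemma k_scaled_eq kappa t z :
  k_scaled kappa t z = (spiral kappa (clock kappa t) * k kappa z)%C.
Proof.
  unfold k_scaled, Rpower_C, spiral, clock. f_equal. f_equal.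
  rewrite RtoC_opp, RtoC_mult. ring.
Qed.

Lemma clock_0 kappa : clock kappa 0 = 0.
Proof. unfold clock. rewrite Rminus_0_r, ln_1. ring. Qed.

Lemma clock_increasing kappa s t : admissible kappa -> s < t < 1 -> clock kappa s < clock kappa t.
Proof.
  intros Ha Hst. apply cos_theta_pos in Ha. unfold clock.
  assert (ln (1 - t) < ln (1 - s)) by (apply ln_increasing; lra). nra.
Qed.

Lemma clock_nonneg kappa t : admissible kappa -> 0 <= t < 1 -> 0 <= clock kappa t.
Proof.
  intros Ha [[Ht|<-] Ht1]; [|rewrite clock_0; lra].
  rewrite <- (clock_0 kappa). left. apply clock_increasing; auto.
Qed.

Lemma clock_pos kappa t : admissible kappa -> 0 < t < 1 -> 0 < clock kappa t.
Proof. intros Ha Ht. rewrite <- (clock_0 kappa). now apply clock_increasing. Qed.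

Lemma clock_inj kappa s t : admissible kappa -> s < 1 -> t < 1 ->
  clock kappa s = clock kappa t -> s = t.
Proof.
  intros Ha Hs Ht E. destruct (Rtotal_order s t) as [H|[H|H]]; [|exact H|].
  - assert (H1 := clock_increasing kappa s t Ha). lra.
  - assert (H1 := clock_increasing kappa t s Ha). lra.
Qed.

Lemma clock_surjective kappa u : admissible kappa -> 0 < u ->
  exists t, 0 < t < 1 /\ clock kappa t = u.
Proof.
  intros Ha Hu. apply cos_theta_pos in Ha.
  exists (1 - exp (- (u / cos (theta kappa)))). split.
  - assert (H := exp_pos (- (u / cos (theta kappa)))).
    assert (H1 : exp (- (u / cos (theta kappa))) < exp 0).
    { apply exp_increasing. assert (0 < u / cos (theta kappa)) by (now apply Rdiv_lt_0_compat). lra. }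
    rewrite exp_0 in H1. lra.
  - unfold clock. replace (1 - (1 - exp (- (u / cos (theta kappa)))))
      with (exp (- (u / cos (theta kappa)))) by ring.
    rewrite ln_exp. field. lra.
Qed.

(** [k z = spiral (- clock s)] says that [z] is the point of the trace at time [s]. *)
Definition swallowed (kappa t : R) (z : C) : Prop :=
  exists s, 0 < s <= t /\ k kappa z = spiral kappa (- clock kappa s).

(** [k_scaled] moves [k z] outwards along its spiral by [clock t]; as [k z] is not on
    [S1], it ends on [S1] exactly if it passes through [1] at some time [s <= t]. *)
Lemma k_scaled_S1 kappa t z : admissible kappa -> 0 <= t < 1 -> UH z ->
  S1 kappa (k_scaled kappa t z) <-> swallowed kappa t z.
Proof.
  intros Ha Ht Hz. rewrite k_scaled_eq. split.
  - intros [u [Hu E]].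
    assert (Ek : k kappa z = spiral kappa (u - clock kappa t)).
    { replace (u - clock kappa t) with (- clock kappa t + u) by ring.
      rewrite spiral_plus, <- E, Cmult_assoc, <- spiral_plus.
      replace (- clock kappa t + clock kappa t) with 0 by ring.
      rewrite spiral_0. ring. }
    assert (H : u < clock kappa t).
    { apply Rnot_le_lt. intros H. apply (k_not_S1 kappa z Ha Hz).
      exists (u - clock kappa t). split; [lra|exact Ek]. }
    destruct (clock_surjective kappa (clock kappa t - u) Ha) as [s [Hs Es]]; [lra|].
    exists s. split.
    + split; [lra|]. apply Rnot_lt_le. intros Hts.
      assert (H1 := clock_increasing kappa t s Ha). lra.
    + rewrite Ek, Es. f_equal. ring.
  - intros [s [Hs E]]. exists (clock kappa t - clock kappa s). split.
    + destruct (proj2 Hs) as [H|<-]; [|lra].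
      assert (H1 := clock_increasing kappa s t Ha). lra.
    + rewrite E, <- spiral_plus. reflexivity.
Qed.

Lemma cdiff_spiral D kappa (f : R -> R) t l : is_derive f t l ->
  cdiff (reals D) (fun w => spiral kappa (f (Re w))) t
    (spiral kappa (f t) * (RtoC l * eith kappa))%C.
Proof.
  intros Hf. unfold spiral.
  apply (cdiff_comp (reals D) total (fun w => RtoC (f (Re w)) * eith kappa)%C Cexp);
    [|apply cdiff_Cexp|easy].
  eapply cdiff_eq; [apply cdiff_mult; [apply cdiff_real, Hf|apply cdiff_const]|].
  cbv beta; ring.
Qed.

Lemma is_derive_clock kappa t : t < 1 ->
  is_derive (clock kappa) t (cos (theta kappa) / (1 - t)).
Proof. intros Ht. unfold clock. auto_derive; [lra|field; lra]. Qed.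

Lemma sqrt_one_minus t : t < 1 -> 0 < sqrt (1 - t) /\ 1 - t = sqrt (1 - t) * sqrt (1 - t).
Proof.
  intros Ht. split; [apply sqrt_lt_R0; lra|]. rewrite sqrt_sqrt; lra.
Qed.

Lemma RtoC_neq_0 (x : R) : x <> 0 -> RtoC x <> 0.
Proof. intros H E. apply RtoC_inj in E. contradiction. Qed.

Lemma g_range kappa t z : admissible kappa -> 0 <= t < 1 -> ~ S1 kappa (k_scaled kappa t z) ->
  UH (g kappa t z).
Proof.
  intros Ha Ht Hs. destruct (k_inv_spec kappa _ Ha Hs) as [H _].
  destruct (sqrt_one_minus t) as [Hr _]; [lra|].
  unfold UH, g in *. rewrite im_scal_l. now apply Rmult_lt_0_compat.
Qed.

(** With [W = g / sqrt (1 - t)], differentiating [k W = k_scaled] gives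
    [(1 - t) W' = cos theta * eith * k W / k' W = (W^2 - kappa W + 4) / (2 (W - kappa))]. *)
Lemma cdiff_g kappa D t z : admissible kappa -> 0 <= t < 1 ->
  ~ S1 kappa (k_scaled kappa t z) ->
  cdiff (reals D) (curve (fun s => g kappa s z)) t
    (2 / (g kappa t z - RtoC (kappa * sqrt (1 - t))))%C.
Proof.
  intros Ha Ht Hs. destruct (k_inv_spec kappa _ Ha Hs) as [HW EW].
  destruct (sqrt_one_minus t) as [Hr Hrr]; [lra|].
  assert (Hne := UH_neq_real _ kappa HW).
  assert (Hab := nonneg_above kappa _ Ha (Rlt_le _ _ HW)).
  assert (Hdk := dk_neq_0 kappa _ Ha Hab Hne).
  assert (Hkd := k_div_dk kappa _ Ha Hab Hne).
  assert (Hns : RtoC (sqrt (1 - t)) <> 0) by (apply RtoC_neq_0; lra).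
  eapply cdiff_eq.
  - unfold curve, g. apply cdiff_mult.
    + apply (cdiff_real D (fun s => sqrt (1 - s)) t (- / (2 * sqrt (1 - t)))).
      auto_derive; [lra|]. change (1 + - t) with (1 - t). field. lra.
    + apply (cdiff_comp (reals D) total (fun w => k_scaled kappa (Re w) z) (k_inv kappa));
        [|apply cdiff_k_inv; assumption|easy].
      unfold k_scaled. fold (k_scaled kappa).
      replace (fun w : C => Rpower_C (1 - Re w) _ * k kappa z)%C
        with (fun w : C => spiral kappa (clock kappa (Re w)) * k kappa z)%C.
      * apply cdiff_mult; [|apply cdiff_const].
        apply cdiff_spiral, is_derive_clock. lra.
      * apply functional_extensionality. intros w. rewrite <- k_scaled_eq. reflexivity.
  - cbv beta. rewrite re_RtoC. unfold g.
    rewrite k_scaled_eq in *.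
    set (K := (spiral kappa (clock kappa t) * k kappa z)%C) in *.
    set (W := k_inv kappa K) in *. rewrite EW in Hkd.
    set (c := cos (theta kappa)) in *. set (r := sqrt (1 - t)) in *.
    rewrite Hrr.
    transitivity (- / (2 * r) * W + / r * (c * eith kappa * K / dk kappa W))%C.
    + rewrite RtoC_opp, RtoC_inv, RtoC_mult, RtoC_div, RtoC_mult by nra. unfold K.
      field. repeat split; auto.
    + rewrite Hkd. rewrite RtoC_mult.
      assert (Hwk := Cminus_eq_contra _ _ Hne).
      assert (Hrwk : (r * W - kappa * r)%C <> 0).
      { replace (r * W - kappa * r)%C with (r * (W - kappa))%C by ring.
        now apply Cmult_neq_0. }
      field. auto.
Qed.

Lemma g_0 kappa z : admissible kappa -> UH z -> g kappa 0 z = z.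
Proof.
  intros Ha Hz. unfold g. rewrite Rminus_0_r, sqrt_1, k_scaled_eq, clock_0, spiral_0.
  rewrite !Cmult_1_l. now apply k_inv_eq.
Qed.

Lemma g_solution kappa t z : admissible kappa -> 0 <= t < 1 -> UH z -> ~ swallowed kappa t z ->
  loewner_solution (lambda kappa) z t (fun s => g kappa s z).
Proof.
  intros Ha Ht Hz Hn.
  assert (HS : forall s, 0 <= s <= t -> ~ S1 kappa (k_scaled kappa s z)).
  { intros s Hs HS. apply Hn. apply k_scaled_S1 in HS; [|exact Ha|lra|exact Hz].
    destruct HS as [v [Hv E]]. exists v. split; [lra|exact E]. }
  split; [now apply g_0|]. intros s Hs. split.
  - apply UH_neq_real. apply g_range; auto. lra.
  - apply cdiff_is_derive_on; [exact Hs|]. apply cdiff_g; auto. lra.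
Qed.

Lemma loewner_cdiff lam z t u s : loewner_solution lam z t u -> 0 <= s <= t ->
  cdiff (reals (fun r => 0 <= r <= t)) (curve u) s (2 / (u s - lam s))%C.
Proof.
  intros [_ H] Hs. apply cdiff_is_derive_on; [exact Hs|]. now apply H.
Qed.

Lemma cdiff_Im D u t l : D t -> cdiff (reals D) (curve u) t l ->
  cdiff (reals D) (fun w => RtoC (Im (u (Re w)))) t (RtoC (Im l)).
Proof.
  intros Ht H. rewrite cdiff_curve_iff in H by exact Ht.
  apply (cdiff_curve_iff D (fun s => RtoC (Im (u s)))); [exact Ht|].
  intros eps He. destruct (H eps He) as [d [Hd H1]]. exists d. split; [exact Hd|].
  intros s Hs Hst. apply Rle_trans with (2 := H1 s Hs Hst).
  rewrite <- RtoC_mult, <- !RtoC_minus, Cmod_R.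
  replace (Im (u s) - Im (u t) - (s - t) * Im l)
    with (Im (u s - u t - RtoC (s - t) * l)); [apply Im_le_Cmod|].
  unfold Cminus. rewrite !im_plus, !im_opp, im_scal_l. ring.
Qed.

(** [y = Im u] satisfies [y' = - 2 y / |u - lam|^2], and [|u - lam|] stays away
    from [0] on the left of any time [s]; so [y (r) exp (A r)] is nondecreasing
    there for large [A] as long as [y > 0], and [y (s) > 0] follows. *)
Lemma loewner_Im_pos lam z t u : UH z -> loewner_solution lam z t u ->
  (forall s, 0 <= s <= t ->
     ccont (reals (fun r => 0 <= r <= t)) (fun w => RtoC (lam (Re w))) s) ->
  forall s, 0 <= s <= t -> UH (u s).
Proof.
  intros Hz Hsol Hlam.
  set (D := fun r => 0 <= r <= t).
  assert (Hcu : forall s, D s -> ccont (reals D) (curve u) s).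
  { intros s Hs. apply (cdiff_ccont _ _ _ _ (loewner_cdiff lam z t u s Hsol Hs)). }
  assert (HR : forall r, D r -> reals D r).
  { intros r Hr. split; [apply im_RtoC|]. now rewrite re_RtoC. }
  apply (real_induction (fun s => UH (u s)) t).
  - intros s Hs Hu. destruct (Hcu s Hs (Im (u s)) Hu) as [d [Hd H]].
    exists d. split; [exact Hd|]. intros r Hr Hrs.
    specialize (H r (HR r Hr)). rewrite Cmod_RtoC_sub in H. specialize (H Hrs).
    unfold curve in H. rewrite !re_RtoC in H.
    exact (near_UH (u s) (u r) H).
  - intros s Hs Hlow. destruct (proj1 Hs) as [Hs0|Hs0].
    2:{ rewrite <- Hs0. destruct Hsol as [-> _]. exact Hz. }
    assert (Hne : 0 < Cmod (u s - lam s)).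
    { apply Cmod_gt_0, Cminus_eq_contra. now apply Hsol. }
    set (a := Cmod (u s - lam s) / 2).
    assert (Hc : ccont (reals D) (fun w => curve u w + - (1) * RtoC (lam (Re w)))%C s).
    { apply ccont_plus; [now apply Hcu|]. apply ccont_mult; [apply ccont_const|].
      now apply Hlam. }
    destruct (Hc a) as [d [Hd H]]; [unfold a; lra|].
    assert (Hfar : forall r, D r -> Rabs (r - s) < d -> a <= Cmod (u r - lam r)).
    { intros r Hr Hrs. specialize (H r (HR r Hr)). rewrite Cmod_RtoC_sub in H.
      specialize (H Hrs). unfold curve in H. rewrite !re_RtoC in H.
      assert (H1 := Cmod_sub_triangle (u s) (u r + lam s - lam r) (lam s)).
      replace (u r + - (1) * lam r - (u s + - (1) * lam s))%C
        with (- (u s - (u r + lam s - lam r)))%C in H by ring. rewrite Cmod_opp in H.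
      replace (u r + lam s - lam r - lam s)%C with (u r - lam r)%C in H1 by ring.
      unfold a in *. lra. }
    set (A := 2 / (a * a)).
    assert (Ha : 0 < a) by (unfold a; lra).
    (* An earlier time from which on [|u - lam| >= a]. *)
    set (q := Rmax 0 (s - d / 2)).
    assert (Hq1 : 0 <= q) by apply Rmax_l.
    assert (Hq2 : s - d / 2 <= q) by apply Rmax_r.
    assert (Hq3 : q < s) by (apply Rmax_lub_lt; lra).
    destruct (curve_MVT
      (fun w => RtoC (Im (u (Re w))) * RtoC (exp (A * Re w)))%C
      (fun r => RtoC (Im (2 / (u r - lam r))) * RtoC (exp (A * r))
         + RtoC (Im (u r)) * RtoC (A * exp (A * r)))%C q s 1 Hq3) as [xi [Hxi E]].
    { intros r Hr. eapply cdiff_eq.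
      - apply cdiff_mult.
        + apply (cdiff_subset _ (reals D)).
          * intros w [Hw1 Hw2]. split; [exact Hw1|]. unfold D in *; lra.
          * apply cdiff_Im; [unfold D in *; lra|].
            apply (loewner_cdiff lam z t u); [exact Hsol|unfold D in *; lra].
        + apply (cdiff_real _ (fun x => exp (A * x)) r (A * exp (A * r))).
          auto_derive; [easy|ring].
      - cbv beta. rewrite re_RtoC. reflexivity. }
    cbv beta in E. rewrite !re_RtoC in E.
    assert (Hy : 0 < Im (u xi)) by (apply Hlow; lra).
    assert (Hyq : 0 < Im (u q)) by (apply Hlow; lra).
    assert (Hfx : a <= Cmod (u xi - lam xi)).
    { apply Hfar; [unfold D; lra|]. apply Rabs_def1; lra. }
    set (v := (u xi - lam xi)%C) in *.
    assert (Hv : v <> 0) by (apply Cmod_gt_0; lra).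
    assert (HIm : Im (2 / v) = - (2 * Im (u xi)) / Cmod v ^ 2).
    { replace (Im (u xi)) with (Im v).
      2:{ unfold v, Cminus. rewrite im_plus, im_opp, im_RtoC. ring. }
      rewrite Cmod2_alt. destruct v as [x y].
      unfold Cdiv. rewrite im_scal_l. unfold Cinv, Re, Im in *; simpl in *.
      field. intros E0. apply Hv. unfold RtoC. f_equal; nra. }
    assert (HA : 2 / Cmod v ^ 2 <= A).
    { unfold A. apply Rmult_le_compat_l; [lra|]. apply Rinv_le_contravar; nra. }
    assert (Hpos : 0 <= Im (2 / v) * exp (A * xi) + Im (u xi) * (A * exp (A * xi))).
    { rewrite HIm. replace (- (2 * Im (u xi)) / Cmod v ^ 2 * exp (A * xi)
        + Im (u xi) * (A * exp (A * xi)))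
        with (Im (u xi) * exp (A * xi) * (A - 2 / Cmod v ^ 2))
        by (field; apply Cmod_gt_0 in Hv; lra).
      assert (He := exp_pos (A * xi)). apply Rmult_le_pos; [|lra].
      apply Rmult_le_pos; lra. }
    rewrite <- !RtoC_mult, <- RtoC_plus, <- RtoC_minus, <- !RtoC_mult, !re_RtoC in E.
    assert (Hs1 := exp_pos (A * s)). assert (Hs2 := exp_pos (A * q)).
    assert (0 < Im (u q) * exp (A * q)) by (now apply Rmult_lt_0_compat).
    assert (0 <= (s - q) * (1 * (Im (2 / v) * exp (A * xi) + Im (u xi) * (A * exp (A * xi))))).
    { apply Rmult_le_pos; lra. }
    assert (0 < Im (u s) * exp (A * s)) by lra.
    unfold UH. nra.
Qed.

Lemma ccont_lambda kappa D t : t < 1 ->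
  ccont (reals D) (fun w => RtoC (lambda kappa (Re w))) t.
Proof.
  intros Ht. eapply cdiff_ccont. apply (cdiff_real D (lambda kappa)).
  unfold lambda. auto_derive; [lra|reflexivity].
Qed.

(** The computation for [g] read backwards: for any solution [u], the quotient of
    [k (u / sqrt (1 - s))] by [spiral (clock s)] has zero derivative. *)
Lemma loewner_conserved kappa z t u s : admissible kappa -> t < 1 -> UH z ->
  loewner_solution (lambda kappa) z t u -> 0 <= s <= t ->
  UH (u s / RtoC (sqrt (1 - s))) /\
  k kappa (u s / RtoC (sqrt (1 - s))) = k_scaled kappa s z.
Proof.
  intros Ha Ht Hz Hsol Hs.
  assert (Him : forall r, 0 <= r <= t -> UH (u r)).
  { apply (loewner_Im_pos (lambda kappa) z t u Hz Hsol).
    intros r Hr. apply ccont_lambda. lra. }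
  assert (HUH : forall r, 0 <= r <= t -> UH (u r * / RtoC (sqrt (1 - r)))).
  { intros r Hr. destruct (sqrt_one_minus r) as [H1 _]; [lra|].
    rewrite <- RtoC_inv by lra. unfold UH. rewrite im_scal_r.
    apply Rmult_lt_0_compat; [now apply Him|]. now apply Rinv_0_lt_compat. }
  split; [now apply HUH|].
  set (F := fun w => (k kappa (u (Re w) * RtoC (/ sqrt (1 - Re w)))
    * spiral kappa (- clock kappa (Re w)))%C).
  assert (Hinv : forall r, r < 1 -> RtoC (/ sqrt (1 - r)) = (/ RtoC (sqrt (1 - r)))%C).
  { intros r Hr. apply RtoC_inv. destruct (sqrt_one_minus r); lra. }
  assert (HF : F s = F 0).
  { apply curve_constant; [lra|]. intros r Hr.
    destruct (sqrt_one_minus r) as [Hr1 Hrr]; [lra|].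
    assert (HW := HUH r ltac:(lra)).
    assert (Hne := UH_neq_real _ kappa HW).
    assert (Hab := nonneg_above kappa _ Ha (Rlt_le _ _ HW)).
    assert (Hkd := k_div_dk kappa _ Ha Hab Hne).
    assert (Hdk := dk_neq_0 kappa _ Ha Hab Hne).
    assert (Hns : RtoC (sqrt (1 - r)) <> 0) by (apply RtoC_neq_0; lra).
    eapply cdiff_eq.
    - unfold F. apply cdiff_mult.
      + apply (cdiff_comp (reals (fun x => 0 <= x <= s)) (above kappa)
          (fun w => u (Re w) * RtoC (/ sqrt (1 - Re w)))%C (k kappa)).
        * apply cdiff_mult.
          -- apply (cdiff_subset _ (reals (fun x => 0 <= x <= t))).
             { intros w [H1 H2]. split; [exact H1|lra]. }
             apply (loewner_cdiff _ _ _ _ r Hsol). lra.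
          -- apply (cdiff_real _ (fun x => / sqrt (1 - x)) r
               (/ (2 * (sqrt (1 - r) * (sqrt (1 - r) * sqrt (1 - r)))))).
             auto_derive; [split; [lra|]|]; replace (1 + - r) with (1 - r) by ring.
             ++ split; [lra|easy].
             ++ field. lra.
        * cbv beta. rewrite re_RtoC, Hinv by lra. apply cdiff_k; assumption.
        * intros w [_ Hw]. rewrite Hinv by lra. apply nonneg_above; [exact Ha|].
          apply Rlt_le, HUH. lra.
      + apply (cdiff_spiral _ kappa (fun x => - clock kappa x) r
          (- (cos (theta kappa) / (1 - r)))).
        exact (is_derive_opp (clock kappa) r _ (is_derive_clock kappa r ltac:(lra))).
    - cbv beta. rewrite !re_RtoC. rewrite !Hinv by lra.
      set (W := (u r * / RtoC (sqrt (1 - r)))%C) in *.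
      unfold lambda.
      replace (u r) with (W * RtoC (sqrt (1 - r)))%C by (unfold W; field; exact Hns).
      clearbody W.
      set (q := sqrt (1 - r)) in *. rewrite Hrr.
      set (c := cos (theta kappa)) in *.
      set (P := spiral kappa (- clock kappa r)).
      transitivity (P * dk kappa W / (q * q) * ((W * W - kappa * W + 4) / (2 * (W - kappa))
        - c * eith kappa * k kappa W / dk kappa W))%C.
      + rewrite RtoC_opp, RtoC_inv, !RtoC_mult, RtoC_div, !RtoC_mult by nra.
        assert (Hwk := Cminus_eq_contra _ _ Hne).
        assert (Hqwk : (W * q - kappa * q)%C <> 0).
        { replace (W * q - kappa * q)%C with (q * (W - kappa))%C by ring.
          now apply Cmult_neq_0. }
        field. auto.
      + rewrite Hkd. ring. }
  unfold F in HF. rewrite !re_RtoC, !Hinv in HF by lra.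
  rewrite clock_0, Ropp_0, spiral_0, Rminus_0_r, sqrt_1 in HF.
  rewrite (proj1 Hsol) in HF.
  replace (z * / RtoC 1)%C with z in HF by field.
  rewrite k_scaled_eq. rewrite Cmult_1_r in HF. rewrite <- HF.
  unfold Cdiv.
  transitivity (k kappa (u s * / RtoC (sqrt (1 - s)))
    * (spiral kappa (- clock kappa s) * spiral kappa (clock kappa s)))%C; [|ring].
  rewrite <- spiral_plus, Rplus_opp_l, spiral_0. ring.
Qed.

(** [g] is a solution as long as [z] is not swallowed; conversely, at the time when
    [z] is swallowed a solution would give a point of the half-plane where [k] is [1]. *)
Lemma loewner_hull_iff kappa t z : admissible kappa -> 0 <= t < 1 ->
  loewner_hull (lambda kappa) t z <-> UH z /\ swallowed kappa t z.
Proof.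
  intros Ha Ht. split.
  - intros [Hz Hn]. split; [exact Hz|]. apply NNPP. intros H. apply Hn.
    exists (fun s => g kappa s z). now apply g_solution.
  - intros [Hz [s [Hs E]]]. split; [exact Hz|]. intros [u Hu].
    destruct (loewner_conserved kappa z t u s Ha) as [HW EW]; try assumption; try lra.
    apply (k_not_S1 kappa _ Ha HW). rewrite EW, k_scaled_eq, E, <- spiral_plus.
    exists 0. split; [lra|]. f_equal. ring.
Qed.

(** * The trace *)

Definition tip (kappa t : R) : C := k_inv kappa (spiral kappa (- clock kappa t)).

Lemma spiral_neg_not_S1 kappa u : admissible kappa -> 0 < u -> ~ S1 kappa (spiral kappa (- u)).
Proof.
  intros Ha Hu [t [Ht E]]. apply spiral_inj in E; [lra|exact Ha].
Qed.

Lemma tip_spec kappa t : admissible kappa -> 0 < t < 1 ->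
  UH (tip kappa t) /\ k kappa (tip kappa t) = spiral kappa (- clock kappa t).
Proof.
  intros Ha Ht. apply k_inv_spec; [exact Ha|]. apply spiral_neg_not_S1; [exact Ha|].
  now apply clock_pos.
Qed.

Lemma tip_unique kappa t z : admissible kappa -> 0 < t < 1 -> UH z ->
  k kappa z = spiral kappa (- clock kappa t) -> z = tip kappa t.
Proof. intros Ha Ht Hz E. symmetry. now apply k_inv_eq. Qed.

Lemma ccont_tip kappa D t : admissible kappa -> 0 < t < 1 ->
  ccont (reals D) (curve (tip kappa)) t.
Proof.
  intros Ha Ht. unfold curve, tip.
  apply (ccont_comp (reals D) total (fun w => spiral kappa (- clock kappa (Re w)))
    (k_inv kappa)); [| |easy].
  - apply (cdiff_ccont _ _ _ _ (cdiff_spiral D kappa (fun x => - clock kappa x) t _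
      (is_derive_opp (clock kappa) t _ (is_derive_clock kappa t (proj2 Ht))))).
  - eapply cdiff_ccont, cdiff_k_inv; [exact Ha|]. rewrite re_RtoC.
    apply spiral_neg_not_S1; [exact Ha|]. now apply clock_pos.
Qed.

Lemma locally_C_intro (P : C -> Prop) z eps : 0 < eps ->
  (forall w, Cmod (w - z) < eps -> P w) -> locally (T := C_UniformSpace) z P.
Proof.
  intros He H. apply locally_C. exists (mkposreal eps He). exact H.
Qed.

Lemma locally_C_elim (P : C -> Prop) z : locally (T := C_UniformSpace) z P ->
  exists eps, 0 < eps /\ forall w, Cmod (w - z) < eps -> P w.
Proof.
  intros H. apply locally_C in H. destruct H as [e H]. exists e.
  split; [apply cond_pos|exact H].
Qed.

Lemma ccont_filterlim D u t : D t -> ccont (reals D) (curve u) t ->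
  filterlim u (within D (locally t)) (locally (T := C_UniformSpace) (u t)).
Proof.
  intros Ht H P HP. destruct (locally_C_elim P (u t) HP) as [e [He HPe]].
  destruct (H e He) as [d [Hd H1]]. exists (mkposreal d Hd). intros s Hs Ds.
  apply HPe. specialize (H1 (RtoC s)). rewrite Cmod_RtoC_sub in H1.
  apply H1; [|exact Hs]. split; [apply im_RtoC|]. now rewrite re_RtoC.
Qed.

Lemma swallowed_iff_arc kappa gamma t z : admissible kappa -> 0 <= t < 1 ->
  (forall s, 0 < s < 1 -> gamma s = tip kappa s) ->
  UH z /\ swallowed kappa t z <-> arc_upto gamma t z.
Proof.
  intros Ha Ht Hg. split.
  - intros [Hz [s [Hs E]]]. exists s. split; [exact Hs|]. rewrite Hg by lra.
    symmetry. apply tip_unique; auto. lra.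
  - intros [s [Hs <-]]. rewrite Hg by lra.
    destruct (tip_spec kappa s Ha) as [H1 H2]; [lra|].
    split; [exact H1|]. exists s. auto.
Qed.

Lemma tip_loewner_trace kappa gamma : admissible kappa ->
  (forall t, 0 < t < 1 -> gamma t = tip kappa t) ->
  loewner_trace (lambda kappa) 1 gamma.
Proof.
  intros Ha Hg. split.
  - intros t Ht. rewrite Hg by exact Ht.
    apply (filterlim_within_ext (fun t => 0 < t < 1) (tip kappa)).
    + intros s Hs. symmetry. now apply Hg.
    + apply (ccont_filterlim (fun t => 0 < t < 1)); [exact Ht|]. now apply ccont_tip.
  - intros t Ht z. rewrite loewner_hull_iff by assumption.
    now apply swallowed_iff_arc.
Qed.

(** The point of [gamma] at time [t] lies in the hull at time [t], so it is the
    tip at an earlier time; that no reparametrization occurs follows because the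
    tip at time [t] must in turn be [gamma s] with [s <= t]. *)
Lemma loewner_trace_tip kappa gamma : admissible kappa ->
  loewner_trace (lambda kappa) 1 gamma ->
  forall t, 0 < t < 1 -> gamma t = tip kappa t.
Proof.
  intros Ha [_ Htr].
  assert (Hin : forall t, 0 < t < 1 -> UH (gamma t) /\ swallowed kappa t (gamma t)).
  { intros t Ht. apply loewner_hull_iff; [exact Ha|lra|]. apply Htr; [lra|].
    exists t. split; [lra|reflexivity]. }
  intros t Ht. destruct (tip_spec kappa t Ha Ht) as [H1 H2].
  assert (Harc : arc_upto gamma t (tip kappa t)).
  { apply Htr; [lra|]. apply loewner_hull_iff; [exact Ha|lra|]. split; [exact H1|].
    exists t. split; [lra|exact H2]. }
  destruct Harc as [s [Hs E]].
  destruct (Hin s) as [_ [v [Hv Ev]]]; [lra|].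
  rewrite E, H2 in Ev. apply spiral_inj in Ev; [|exact Ha].
  assert (t = v) by (apply (clock_inj kappa); [exact Ha|lra|lra|lra]).
  assert (s = t) by lra. now subst s.
Qed.

(** * The maps g *)

Lemma slit_iff kappa gamma t z : admissible kappa -> 0 <= t < 1 ->
  (forall s, 0 < s < 1 -> gamma s = tip kappa s) ->
  slit gamma t z <-> UH z /\ ~ S1 kappa (k_scaled kappa t z).
Proof.
  intros Ha Ht Hg. unfold slit.
  assert (H := swallowed_iff_arc kappa gamma t z Ha Ht Hg).
  split; intros [Hz Hn]; (split; [exact Hz|]); intros H1; apply Hn.
  - apply k_scaled_S1 in H1; tauto.
  - apply k_scaled_S1; tauto.
Qed.

(** [g] is [k], a multiplication carrying the slit image off [S1], and the inverse of
    [k]; the multiplication maps onto the complement of [S1] because its inverse moves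
    points inwards along spirals and hence never onto [S1]. *)
Lemma g_conformal kappa t (A : C -> Prop) : admissible kappa -> 0 <= t < 1 ->
  (forall z, A z <-> UH z /\ ~ S1 kappa (k_scaled kappa t z)) ->
  conformal_onto A UH (g kappa t).
Proof.
  intros Ha Ht HA. destruct (sqrt_one_minus t) as [Hr _]; [lra|].
  assert (Hns : RtoC (sqrt (1 - t)) <> 0) by (apply RtoC_neq_0; lra).
  assert (Hsp : spiral kappa (clock kappa t) <> 0) by apply Cexp_neq_0.
  split; [|split; [|split]].
  - intros z Hz. apply HA in Hz. destruct Hz as [Hz HS].
    eexists. apply cdiff_is_derive.
    apply (cdiff_local (above kappa) total _ _ _ (Im z) Hz).
    + intros w _ Hw. apply nonneg_above; [exact Ha|]. apply Rlt_le, (near_UH z), Hw.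
    + unfold g. apply cdiff_scal.
      apply (cdiff_comp (above kappa) total (k_scaled kappa t) (k_inv kappa));
        [|now apply cdiff_k_inv|easy].
      unfold k_scaled. apply cdiff_scal. apply cdiff_k; [exact Ha|].
      apply nonneg_above; [exact Ha|]. now apply Rlt_le.
  - intros z Hz. apply HA in Hz. now apply g_range.
  - intros z w Hz Hw E. apply HA in Hz. apply HA in Hw.
    destruct Hz as [Hz Hz'], Hw as [Hw Hw'].
    apply (k_injective kappa); [exact Ha|exact Hz|now apply Rlt_le|].
    destruct (k_inv_spec kappa _ Ha Hz') as [_ Ez].
    destruct (k_inv_spec kappa _ Ha Hw') as [_ Ew].
    assert (E1 : k_scaled kappa t z = k_scaled kappa t w).
    { rewrite <- Ez, <- Ew. f_equal. unfold g in E.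
      apply (f_equal (fun x => / RtoC (sqrt (1 - t)) * x)%C) in E.
      rewrite !Cmult_assoc, Cinv_l, !Cmult_1_l in E by exact Hns. exact E. }
    rewrite !k_scaled_eq in E1.
    apply (f_equal (fun x => / spiral kappa (clock kappa t) * x)%C) in E1.
    rewrite !Cmult_assoc, Cinv_l, !Cmult_1_l in E1 by exact Hsp. exact E1.
  - intros w Hw. set (v := (w * RtoC (/ sqrt (1 - t)))%C).
    assert (Hv : UH v).
    { unfold UH, v in *. rewrite im_scal_r. apply Rmult_lt_0_compat; [exact Hw|].
      now apply Rinv_0_lt_compat. }
    set (q := (k kappa v * spiral kappa (- clock kappa t))%C).
    assert (Hq : ~ S1 kappa q).
    { intros H. apply (k_not_S1 kappa v Ha Hv).
      apply (S1_spiral_mult kappa _ (clock kappa t)); [now apply clock_nonneg|].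
      replace (- (clock kappa t * eith kappa))%C
        with (RtoC (- clock kappa t) * eith kappa)%C by (rewrite RtoC_opp; ring).
      exact H. }
    destruct (k_surjective kappa q Ha Hq) as [z [Hz Ez]].
    assert (Es : k_scaled kappa t z = k kappa v).
    { rewrite k_scaled_eq, Ez. unfold q.
      transitivity (k kappa v * (spiral kappa (clock kappa t) * spiral kappa (- clock kappa t)))%C;
        [ring|]. rewrite <- spiral_plus, Rplus_opp_r, spiral_0. ring. }
    exists z. split.
    + apply HA. split; [exact Hz|]. rewrite Es. now apply k_not_S1.
    + unfold g. rewrite Es, (k_inv_eq kappa v) by (auto; reflexivity).
      unfold v. rewrite RtoC_inv by lra. field. exact Hns.
Qed.

(** For large [|z|] the trajectory stays within distance [1] of [z], because as
    long as it does its speed is below [1 / 2]; then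
    [g' - 2 / z = 2 (z - g + lam) / ((g - lam) z)] is [O (1 / z ^ 2)]. *)
Lemma loewner_far lam z t u : 0 <= t <= 1 -> 10 < Cmod z ->
  (forall s, 0 <= s <= t -> Cmod (RtoC (lam s)) <= 4) ->
  loewner_solution lam z t u ->
  Cmod (u t - (z + RtoC (2 * t) / z)) <= 20 / Cmod z ^ 2.
Proof.
  intros Ht Hz Hlam Hsol.
  assert (Hcd := fun s Hs => loewner_cdiff lam z t u s Hsol Hs).
  assert (Hfar : forall s, 0 <= s <= t -> Cmod (u s - z) < 1 ->
    Cmod z / 2 <= Cmod (u s - lam s)).
  { intros s Hs H. assert (H1 := Cmod_sub_triangle z (u s - lam s) 0).
    assert (H2 := Cmod_triangle (z - u s) (lam s)). specialize (Hlam s Hs).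
    replace (z - (u s - lam s))%C with (z - u s + lam s)%C in H1 by ring.
    rewrite Cmod_sub_sym in H.
    replace (z - 0)%C with z in H1 by ring.
    replace (u s - lam s - 0)%C with (u s - lam s)%C in H1 by ring. lra. }
  assert (Hnear : forall s, 0 <= s <= t -> Cmod (u s - z) < 1).
  { apply real_induction.
    - intros s Hs H. destruct (cdiff_ccont _ _ _ _ (Hcd s Hs) (1 - Cmod (u s - z)))
        as [d [Hd H1]]; [lra|].
      exists d. split; [exact Hd|]. intros r Hr Hrs.
      specialize (H1 (RtoC r)). rewrite Cmod_RtoC_sub in H1.
      assert (H2 : Cmod (u r - u s) < 1 - Cmod (u s - z)).
      { apply H1; [|exact Hrs]. split; [apply im_RtoC|]. now rewrite re_RtoC. }
      assert (H3 := Cmod_sub_triangle (u r) (u s) z). lra.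
    - intros s Hs Hlow.
      assert (H : Cmod (curve u s - curve u 0) <= 1 / 2 * (s - 0)).
      { apply (curve_increment_le _ (fun r => 2 / (u r - lam r))%C); [lra| |].
        - intros r Hr. apply (cdiff_subset _ (reals (fun r => 0 <= r <= t))).
          + intros w [Hw1 Hw2]. split; [exact Hw1|lra].
          + apply Hcd. lra.
        - intros r Hr. assert (H1 := Hfar r ltac:(lra) (Hlow r ltac:(lra))).
          rewrite Cmod_div by (apply Cmod_gt_0; lra).
          rewrite Cmod_R, Rabs_pos_eq by lra.
          apply Rle_div_l; lra. }
      unfold curve in H. rewrite !re_RtoC in H. rewrite (proj1 Hsol) in H. lra. }
  assert (Hz0 : z <> 0) by (apply Cmod_gt_0; lra).
  assert (H : Cmod ((curve u t + - (2 / z) * t) - (curve u 0 + - (2 / z) * 0))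
    <= 20 / Cmod z ^ 2 * (t - 0)).
  { apply (curve_increment_le (fun w => curve u w + - (2 / z) * w)%C
      (fun r => 2 / (u r - lam r) + - (2 / z) * 1)%C); [lra| |].
    - intros r Hr. apply cdiff_plus; [now apply Hcd|]. apply cdiff_scal, cdiff_id.
    - intros r Hr. assert (H1 := Hfar r ltac:(lra) (Hnear r ltac:(lra))).
      assert (Hn : (u r - lam r)%C <> 0) by (apply Cmod_gt_0; lra).
      replace (2 / (u r - lam r) + - (2 / z) * 1)%C
        with (2 * (z - u r + lam r) / ((u r - lam r) * z))%C by (field; auto).
      rewrite Cmod_div by (now apply Cmult_neq_0).
      rewrite !Cmod_mult, Cmod_R, Rabs_pos_eq by lra.
      assert (H2 := Cmod_triangle (z - u r) (lam r)).
      assert (H3 := Hnear r ltac:(lra)). rewrite Cmod_sub_sym in H3.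
      assert (H4 := Hlam r ltac:(lra)).
      apply Rle_div_l; [apply Rmult_lt_0_compat; lra|].
      assert (H5 : 20 / Cmod z ^ 2 * (Cmod z / 2 * Cmod z)
        <= 20 / Cmod z ^ 2 * (Cmod (u r - lam r) * Cmod z)).
      { apply Rmult_le_compat_l.
        - left. apply Rdiv_lt_0_compat; [lra|]. apply pow_lt; lra.
        - apply Rmult_le_compat_r; lra. }
      replace (20 / Cmod z ^ 2 * (Cmod z / 2 * Cmod z)) with 10 in H5 by (field; lra).
      lra. }
  unfold curve in H. rewrite !re_RtoC, (proj1 Hsol) in H.
  replace (u t - (z + RtoC (2 * t) / z))%C
    with (u t + - (2 / z) * t - (z + - (2 / z) * 0))%C
    by (rewrite RtoC_mult; field; exact Hz0).
  apply Rle_trans with (1 := H).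
  assert (0 <= 20 / Cmod z ^ 2).
  { left. apply Rdiv_lt_0_compat; [lra|]. apply pow_lt; lra. }
  nra.
Qed.

Lemma Cmod_lambda_le kappa s : admissible kappa -> 0 <= s <= 1 -> Cmod (RtoC (lambda kappa s)) <= 4.
Proof.
  intros [H1 H2] Hs. rewrite Cmod_R. unfold lambda. rewrite Rabs_mult.
  assert (Hq : Rabs (sqrt (1 - s)) <= 1).
  { rewrite Rabs_pos_eq by apply sqrt_pos.
    apply Rle_trans with (sqrt 1); [apply sqrt_le_1_alt; lra|rewrite sqrt_1; lra]. }
  assert (Hk : Rabs kappa <= 4) by (apply Rabs_le; lra).
  replace 4 with (4 * 1) by ring.
  apply Rmult_le_compat; auto using Rabs_pos.
Qed.

Lemma g_hydrodynamic kappa t (A : C -> Prop) : admissible kappa -> 0 <= t < 1 ->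
  (forall z, A z -> UH z /\ ~ S1 kappa (k_scaled kappa t z)) ->
  hydrodynamic A t (g kappa t).
Proof.
  intros Ha Ht HA. exists 20, 10. split; [lra|]. intros z Hz Hr.
  destruct (HA z Hz) as [Hu HS].
  apply (loewner_far (lambda kappa) z t (fun s => g kappa s z)); [lra|exact Hr| |].
  - intros s Hs. apply Cmod_lambda_le; [exact Ha|lra].
  - apply g_solution; auto. intros H. apply HS. now apply k_scaled_S1.
Qed.

(** * Geometry of the spirals *)

Lemma log_spiral_spiral kappa : admissible kappa -> kappa <> 0 -> log_spiral (spiral kappa).
Proof.
  intros Ha Hk. assert (Hc := cos_theta_pos kappa Ha). assert (Hs := sin_theta kappa Ha).
  set (S := sin (theta kappa)) in *. set (D := cos (theta kappa)) in *.
  assert (HS : S <> 0) by lra.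
  exists 1, (D / S), (fun t => t * S). split; [lra|]. split; [|split; [|split]].
  - unfold Rdiv. apply Rmult_integral_contrapositive_currified; [lra|].
    now apply Rinv_neq_0_compat.
  - intros t _ P HP.
    assert (H : continuous (fun t : R => t * S) t).
    { apply (continuous_mult (fun t : R => t) (fun _ => S));
        [apply continuous_id|apply continuous_const]. }
    generalize (H P HP). unfold filtermap, within. apply filter_imp. auto.
  - intros s t _ _ E. now apply Rmult_eq_reg_r in E.
  - intros t _. unfold spiral, Cexp. rewrite eith_eq. fold S D.
    unfold Ci, RtoC, Re, Im, Cmult; simpl.
    replace (t * D - 0 * S) with (t * D) by ring.
    replace (t * S + 0 * D) with (t * S) by ring.
    replace (0 * (t * S) - 1 * 0) with 0 by ring.
    replace (0 * 0 + 1 * (t * S)) with (t * S) by ring.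
    replace (D / S * (t * S)) with (t * D) by (field; exact HS).
    rewrite exp_0. f_equal; ring.
Qed.

Lemma spiral_unbounded kappa : admissible kappa ->
  filterlim (fun t => Cmod (spiral kappa t)) (Rbar_locally p_infty) (Rbar_locally p_infty).
Proof.
  intros Ha. assert (Hc := cos_theta_pos kappa Ha).
  intros P [M HM]. exists (Rabs M / cos (theta kappa)). intros t Ht. apply HM.
  rewrite Cmod_spiral. apply Rlt_div_l in Ht; [|exact Hc].
  assert (H := exp_ineq1_le (t * cos (theta kappa))). assert (H1 := Rle_abs M). lra.
Qed.

Lemma tip_near kappa z0 : admissible kappa ->
  (forall z, 0 <= Im z -> k kappa z = k kappa z0 -> z = z0) ->
  forall (F : (R -> Prop) -> Prop), Filter F ->
  F (fun t => 0 < t < 1) ->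
  (forall eps, 0 < eps -> F (fun t => Cmod (spiral kappa (- clock kappa t) - k kappa z0) < eps)) ->
  filterlim (tip kappa) F (locally (T := C_UniformSpace) z0).
Proof.
  intros Ha Hu F FF H01 Hlim P HP. destruct (locally_C_elim P z0 HP) as [e [He HPe]].
  destruct (k_near kappa z0 Ha Hu e He) as [d [Hd H]].
  generalize (filter_and _ _ H01 (Hlim d Hd)). unfold filtermap. apply filter_imp.
  intros t [Ht H1]. destruct (tip_spec kappa t Ha Ht) as [H2 H3].
  apply HPe, H; [now apply Rlt_le|]. now rewrite H3.
Qed.

Lemma at_right_0_unit : at_right 0 (fun t => 0 < t < 1).
Proof.
  exists (mkposreal 1 Rlt_0_1). intros t Ht H0.
  change (Rabs (t - 0) < 1) in Ht. apply Rabs_def2 in Ht. lra.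
Qed.

Lemma at_left_1_intro (P : R -> Prop) d : 0 < d ->
  (forall t, 1 - d < t < 1 -> P t) -> at_left 1 P.
Proof.
  intros Hd H. exists (mkposreal d Hd). intros t Ht H1.
  change (Rabs (t - 1) < d) in Ht. apply Rabs_def2 in Ht. apply H. lra.
Qed.

Lemma at_left_1_unit : at_left 1 (fun t => 0 < t < 1).
Proof. apply (at_left_1_intro _ 1); [lra|]. intros t Ht. lra. Qed.

Lemma clock_at_left_1 kappa M : admissible kappa -> at_left 1 (fun t => M < clock kappa t).
Proof.
  intros Ha. destruct (clock_surjective kappa (Rabs M + 1) Ha) as [t0 [Ht0 E]].
  { assert (H := Rabs_pos M). lra. }
  apply (at_left_1_intro _ (1 - t0)); [lra|]. intros t Ht.
  assert (H := clock_increasing kappa t0 t Ha). assert (H1 := Rle_abs M). lra.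
Qed.

Lemma tip_at_right_0 kappa : admissible kappa ->
  filterlim (tip kappa) (at_right 0) (locally (T := C_UniformSpace) (RtoC kappa)).
Proof.
  intros Ha. apply tip_near; [exact Ha| |apply within_filter, locally_filter
    |apply at_right_0_unit|].
  - intros z Hz. rewrite k_kappa by exact Ha. intros E. destruct Hz as [Hz|Hz].
    + elim (k_not_S1 kappa z Ha Hz). exists 0. split; [lra|]. now rewrite spiral_0.
    + assert (Ez : z = RtoC (Re z)) by (apply injective_projections; [reflexivity|auto]).
      rewrite Ez in *. f_equal. now apply k_real_eq_1.
  - intros eps He. rewrite k_kappa by exact Ha.
    destruct (cdiff_ccont _ _ _ _ (cdiff_spiral (fun _ => True) kappa
      (fun x => - clock kappa x) 0 _ (is_derive_opp (clock kappa) 0 _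
      (is_derive_clock kappa 0 Rlt_0_1))) eps He) as [d [Hd H]].
    exists (mkposreal d Hd). intros t Ht _.
    specialize (H (RtoC t)). rewrite Cmod_RtoC_sub, !re_RtoC, clock_0, Ropp_0, spiral_0 in H.
    apply H; [|exact Ht]. split; [apply im_RtoC|exact I].
Qed.

Lemma tip_at_left_1 kappa : admissible kappa ->
  filterlim (tip kappa) (at_left 1) (locally (T := C_UniformSpace) (beta kappa)).
Proof.
  intros Ha. assert (Hc := cos_theta_pos kappa Ha).
  apply tip_near; [exact Ha| |apply within_filter, locally_filter
    |apply at_left_1_unit|].
  - intros z Hz. rewrite k_beta by exact Ha. now apply k_eq_0.
  - intros eps He. rewrite k_beta by exact Ha.
    generalize (clock_at_left_1 kappa (/ eps / cos (theta kappa)) Ha). apply filter_imp.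
    intros t Ht. replace (spiral kappa (- clock kappa t) - 0)%C
      with (spiral kappa (- clock kappa t)) by ring.
    rewrite Cmod_spiral, Ropp_mult_distr_l_reverse, exp_Ropp.
    apply Rlt_div_l in Ht; [|exact Hc].
    assert (H := exp_ineq1_le (clock kappa t * cos (theta kappa))).
    rewrite <- (Rinv_inv eps). assert (H1 := Rinv_0_lt_compat eps He).
    apply Rinv_lt_contravar; [|lra]. apply Rmult_lt_0_compat; lra.
Qed.

(** A logarithm of [tip - beta], read off from
    [(z - beta) exp (eith^2 log (z - conj beta)) = k_num kappa * k z] on the trace. *)
Definition tip_log (kappa t : R) : C :=
  (RtoC (- clock kappa t) * eith kappa
   + (eith kappa * RtoC (2 * Re (eith kappa * base_log kappa kappa))
      - eith kappa * eith kappa * base_log kappa (tip kappa t)))%C.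

Lemma tip_log_spec kappa t : admissible kappa -> 0 < t < 1 ->
  (tip kappa t - beta kappa)%C = Cexp (tip_log kappa t).
Proof.
  intros Ha Ht. destruct (tip_spec kappa t Ha Ht) as [_ E].
  unfold tip_log. rewrite Cexp_plus. fold (spiral kappa (- clock kappa t)).
  rewrite <- E. unfold Cminus at 2. rewrite Cexp_plus, <- k_num_real by exact Ha.
  unfold k. rewrite (k_num_eq kappa (tip kappa t)), Cexp_opp.
  field. split; [apply Cexp_neq_0|]. now apply k_num_kappa_neq_0.
Qed.

Lemma ccont_base_log_tip kappa D t : admissible kappa -> 0 < t < 1 ->
  (forall s, D s -> 0 < s < 1) ->
  ccont (reals D) (curve (fun s => base_log kappa (tip kappa s))) t.
Proof.
  intros Ha Ht HD. apply (ccont_comp (reals D) (above kappa) (curve (tip kappa)) (base_log kappa)).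
  - now apply ccont_tip.
  - eapply cdiff_ccont. apply cdiff_base_log. apply nonneg_above; [exact Ha|].
    apply Rlt_le. now apply tip_spec.
  - intros w [_ Hw]. apply nonneg_above; [exact Ha|].
    apply Rlt_le. apply tip_spec; auto.
Qed.

Lemma tip_arg_continuous kappa : admissible kappa ->
  continuous_on (fun t => 0 < t < 1) (fun t => Im (tip_log kappa t)).
Proof.
  intros Ha t Ht. set (D := fun t => 0 < t < 1).
  assert (H : ccont (reals D) (curve (tip_log kappa)) t).
  { unfold tip_log. unfold curve, Cminus.
    apply ccont_plus; [apply ccont_mult; [|apply ccont_const]|].
    - apply (cdiff_ccont _ _ _ _ (cdiff_real D (fun x => - clock kappa x) t _
        (is_derive_opp (clock kappa) t _ (is_derive_clock kappa t (proj2 Ht))))).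
    - apply ccont_plus; [apply ccont_const|].
      apply (ccont_ext _ (fun w => - (1) * (eith kappa * eith kappa
        * curve (fun s => base_log kappa (tip kappa s)) w))%C).
      + split; [apply im_RtoC|]. now rewrite re_RtoC.
      + intros w _. unfold curve. ring.
      + apply ccont_mult; [apply ccont_const|]. apply ccont_mult; [apply ccont_const|].
        apply ccont_base_log_tip; auto. }
  apply filterlim_locally. intros eps. destruct (H eps (cond_pos eps)) as [d [Hd H1]].
  exists (mkposreal d Hd). intros s Hs Ds. specialize (H1 (RtoC s)).
  rewrite Cmod_RtoC_sub in H1. unfold curve in H1. rewrite !re_RtoC in H1.
  assert (H2 : Cmod (tip_log kappa s - tip_log kappa t) < eps).
  { apply H1; [|exact Hs]. split; [apply im_RtoC|]. now rewrite re_RtoC. }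
  change (Rabs (Im (tip_log kappa s) - Im (tip_log kappa t)) < eps).
  apply Rle_lt_trans with (2 := H2). exact (Im_le_Cmod (tip_log kappa s - tip_log kappa t)).
Qed.

(** The logarithm of [tip - conj beta] converges as the tip tends to [beta], so the
    argument of [tip - beta] follows the one of [spiral (- clock)] up to a bounded error. *)
Lemma tip_arg_near_beta kappa : admissible kappa -> exists B, at_left 1 (fun t =>
  Rabs (Im (tip_log kappa t) + sin (theta kappa) * clock kappa t) <= B).
Proof.
  intros Ha.
  set (q := (eith kappa * RtoC (2 * Re (eith kappa * base_log kappa kappa)))%C).
  set (e2 := (eith kappa * eith kappa)%C).
  exists (Cmod q + Cmod e2 * (Cmod (base_log kappa (beta kappa)) + 1)).
  assert (Hab : above kappa (beta kappa)).
  { apply nonneg_above; [exact Ha|]. now apply Rlt_le, UH_beta. }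
  destruct (cdiff_ccont _ _ _ _ (cdiff_base_log kappa _ Hab) 1 Rlt_0_1) as [d [Hd H]].
  assert (HF : Filter (at_left 1)) by apply within_filter, locally_filter.
  generalize (filter_and _ _ at_left_1_unit (tip_at_left_1 kappa Ha _
    (locally_C_intro (fun w => Cmod (w - beta kappa) < d) _ d Hd (fun w Hw => Hw)))).
  apply filter_imp. intros t [Ht Htip].
  destruct (tip_spec kappa t Ha Ht) as [Hu _].
  specialize (H (tip kappa t) (nonneg_above kappa _ Ha (Rlt_le _ _ Hu)) Htip).
  replace (Im (tip_log kappa t) + sin (theta kappa) * clock kappa t)
    with (Im (q - e2 * base_log kappa (tip kappa t))).
  2:{ unfold tip_log. fold q e2. rewrite (im_plus (_ * eith kappa)), im_scal_l.
      rewrite eith_eq at 1. unfold Im at 2; simpl snd. ring. }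
  apply Rle_trans with (1 := Im_le_Cmod _).
  apply Rle_trans with (1 := Cmod_triangle _ _). rewrite Cmod_opp, Cmod_mult.
  apply Rplus_le_compat_l, Rmult_le_compat_l; [apply Cmod_ge_0|].
  assert (H1 := Cmod_sub_le (base_log kappa (tip kappa t)) (base_log kappa (beta kappa))). lra.
Qed.

Lemma tip_spirals kappa gamma : admissible kappa -> kappa <> 0 ->
  (forall t, 0 < t < 1 -> gamma t = tip kappa t) ->
  spirals_around gamma 1 (beta kappa).
Proof.
  intros Ha Hk Hg.
  assert (HF : Filter (at_left 1)) by apply within_filter, locally_filter.
  split.
  { apply (filterlim_ext_loc (tip kappa)); [|now apply tip_at_left_1].
    generalize at_left_1_unit. apply filter_imp. intros t Ht. symmetry. now apply Hg. }
  exists (fun t => Im (tip_log kappa t)). split; [now apply tip_arg_continuous|]. split.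
  - intros t Ht. rewrite Hg by exact Ht. assert (E := tip_log_spec kappa t Ha Ht). split.
    + intros E1. rewrite E1 in E. apply (Cexp_neq_0 (tip_log kappa t)).
      rewrite <- E. ring.
    + rewrite E. apply Cexp_polar.
  - assert (Hs := sin_theta kappa Ha). set (S := sin (theta kappa)) in *.
    destruct (tip_arg_near_beta kappa Ha) as [B HB]. fold S in HB.
    destruct (Rtotal_order S 0) as [HS|[HS|HS]]; [left| |right].
    2:{ exfalso. apply Hk. rewrite Hs, HS. ring. }
    + intros P [M HM].
      generalize (filter_and _ _ HB (clock_at_left_1 kappa ((Rabs M + B) / - S) Ha)).
      unfold filtermap. apply filter_imp. intros t [H1 H2]. apply HM.
      apply Rlt_div_l in H2; [|lra]. apply Rabs_le_between in H1.
      assert (H3 := Rle_abs M). lra.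
    + intros P [M HM].
      generalize (filter_and _ _ HB (clock_at_left_1 kappa ((Rabs M + B) / S) Ha)).
      unfold filtermap. apply filter_imp. intros t [H1 H2]. apply HM.
      apply Rlt_div_l in H2; [|lra]. apply Rabs_le_between in H1.
      assert (H3 := Rle_abs (- M)). rewrite Rabs_Ropp in H3. lra.
Qed.

(** * Reflection *)

Lemma theta_opp kappa : theta (- kappa) = - theta kappa.
Proof.
  unfold theta. replace (- kappa / 4) with (- (kappa / 4)) by field. now rewrite asin_opp.
Qed.

Lemma eith_opp kappa : eith (- kappa) = Cconj (eith kappa).
Proof.
  rewrite !eith_eq, theta_opp, cos_neg, sin_neg. reflexivity.
Qed.

Lemma beta_opp kappa : beta (- kappa) = refl (beta kappa).
Proof.
  rewrite !beta_eq, theta_opp, cos_neg, sin_neg. unfold refl, Cconj, Copp; simpl.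
  f_equal; ring.
Qed.

Lemma clock_opp kappa t : clock (- kappa) t = clock kappa t.
Proof. unfold clock. now rewrite theta_opp, cos_neg. Qed.

Lemma spiral_opp kappa t : spiral (- kappa) t = Cconj (spiral kappa t).
Proof.
  unfold spiral. rewrite eith_opp, <- Cexp_conj, Cmult_conj. f_equal. f_equal.
  unfold Cconj, RtoC; simpl. f_equal; ring.
Qed.

Lemma admissible_opp kappa : admissible kappa -> admissible (- kappa).
Proof. unfold admissible. lra. Qed.

Lemma refl_refl z : refl (refl z) = z.
Proof. destruct z as [x y]. unfold refl, Cconj, Copp; simpl. f_equal; ring. Qed.

Lemma UH_refl z : UH z -> UH (refl z).
Proof. destruct z as [x y]. unfold UH, refl, Cconj, Copp, Im; simpl. lra. Qed.

Lemma Clog_refl z : UH z -> Clog (refl z) = (Cconj (Clog z) + Ci * PI)%C.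
Proof.
  destruct z as [x y]. intros H. unfold UH, Im in H; simpl in H.
  assert (Hm : Cmod (refl (x, y)) = Cmod (x, y)).
  { unfold refl. now rewrite Cmod_opp, Cmod_conj. }
  unfold Clog. rewrite Hm. unfold refl, Re, Im, Cconj, Copp, Ci, RtoC, Cplus, Cmult; simpl.
  replace (- x / - - y) with (- (x / y)) by (field; lra). rewrite atan_opp.
  f_equal; lra.
Qed.

(** The two branches of the logarithm differ by [i pi] after reflection, which
    costs a constant factor; it cancels in [k]. *)
Lemma k_num_refl kappa z : above kappa z ->
  k_num (- kappa) (refl z)
  = (- Cexp (Cconj (eith kappa * eith kappa) * (Ci * PI)) * Cconj (k_num kappa z))%C.
Proof.
  intros Hz. rewrite !k_num_eq, beta_opp.
  replace (refl z - refl (beta kappa))%C with (- Cconj (z - beta kappa))%C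
    by (unfold refl; rewrite Cminus_conj; ring).
  replace (base_log (- kappa) (refl z)) with (Cconj (base_log kappa z) + Ci * PI)%C.
  - rewrite eith_opp, <- Cmult_conj, Cmult_plus_distr_l, Cexp_plus, <- Cmult_conj, Cexp_conj.
    rewrite (Cmult_conj (z - beta kappa)). ring.
  - unfold base_log. rewrite beta_opp.
    replace (refl z - Cconj (refl (beta kappa)))%C with (refl (z - Cconj (beta kappa))).
    + symmetry. now apply Clog_refl, above_UH.
    + unfold refl. rewrite !Cminus_conj, Copp_conj, !Cconj_conj. ring.
Qed.

Lemma k_refl kappa z : admissible kappa -> above kappa z ->
  k (- kappa) (refl z) = Cconj (k kappa z).
Proof.
  intros Ha Hz. assert (HN := k_num_kappa_neq_0 kappa Ha).
  assert (Hr : RtoC (- kappa) = refl kappa).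
  { unfold refl, RtoC, Cconj, Copp; simpl. f_equal; ring. }
  unfold k. rewrite Hr, !k_num_refl by (auto using real_above).
  rewrite Cdiv_conj by exact HN. field. split; [|apply Cexp_neq_0].
  apply Cmod_gt_0. rewrite Cmod_conj. now apply Cmod_gt_0.
Qed.

Lemma tip_refl kappa t : admissible kappa -> 0 < t < 1 -> refl (tip (- kappa) t) = tip kappa t.
Proof.
  intros Ha Ht. assert (Ha' := admissible_opp kappa Ha).
  destruct (tip_spec (- kappa) t Ha' Ht) as [H E].
  apply tip_unique; [exact Ha|exact Ht|now apply UH_refl|].
  assert (Hk := k_refl (- kappa) (tip (- kappa) t) Ha'
    (nonneg_above _ _ Ha' (Rlt_le _ _ H))).
  rewrite Ropp_involutive in Hk. rewrite Hk, E, spiral_opp, Cconj_conj, clock_opp.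
  reflexivity.
Qed.

Lemma g_refl kappa t z : admissible kappa -> 0 <= t < 1 -> UH z ->
  ~ S1 kappa (k_scaled kappa t z) -> g kappa t z = refl (g (- kappa) t (refl z)).
Proof.
  intros Ha Ht Hz HS. assert (Ha' := admissible_opp kappa Ha).
  destruct (k_inv_spec kappa _ Ha HS) as [HW EW].
  unfold g. rewrite (k_inv_eq (- kappa) (refl (k_inv kappa (k_scaled kappa t z)))).
  - unfold refl. rewrite Cmult_conj, Copp_conj, Cconj_conj.
    replace (Cconj (RtoC (sqrt (1 - t)))) with (RtoC (sqrt (1 - t)))
      by (unfold Cconj, RtoC; simpl; f_equal; ring). ring.
  - exact Ha'.
  - now apply UH_refl.
  - assert (Hab : forall v, UH v -> above kappa v).
    { intros v Hv. apply nonneg_above; [exact Ha|now apply Rlt_le]. }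
    rewrite k_refl, EW by auto.
    rewrite !k_scaled_eq, k_refl, spiral_opp, clock_opp by auto.
    apply Cmult_conj.
Qed.

Theorem proposition3p3 :
  forall kappa : R, (0 < kappa < 4 \/ -4 < kappa < 0) ->
  (* k is conformal onto the complement of a logarithmic spiral *)
  conformal_onto UH (fun w => ~ S1 kappa w) (k kappa) /\
  (log_spiral (spiral kappa) /\ spiral kappa 0 = RtoC 1 /\
   filterlim (fun t => Cmod (spiral kappa t))
     (Rbar_locally p_infty) (Rbar_locally p_infty)) /\
  (* the trace exists, and is the following curve *)
  (exists gamma, loewner_trace (lambda kappa) 1 gamma) /\
  (forall gamma, loewner_trace (lambda kappa) 1 gamma ->
     (forall z, (exists t, 0 < t < 1 /\ gamma t = z) <->
        (UH z /\ exists t, 0 < t /\ k kappa z = Cexp (- (RtoC t * eith kappa)))) /\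
     (forall t, 0 < t < 1 -> UH (gamma t)) /\
     filterlim gamma (at_right 0) (locally (T := C_UniformSpace) (RtoC kappa)) /\
     UH (beta kappa) /\ spirals_around gamma 1 (beta kappa) /\
     (* g_t is well defined on the slit half-plane, is its normalized
        conformal map, and satisfies the Loewner equation *)
     (forall t, 0 <= t < 1 ->
        (forall z, slit gamma t z -> ~ S1 kappa (k_scaled kappa t z)) /\
        conformal_onto (slit gamma t) UH (g kappa t) /\
        hydrodynamic (slit gamma t) t (g kappa t) /\
        (forall z, slit gamma t z ->
           is_derive_on (fun s => 0 <= s < 1) (fun s => g kappa s z) t
             (2 / (g kappa t z - RtoC (kappa * sqrt (1 - t))))%C)) /\
     (forall z, UH z -> g kappa 0 z = z)) /\
  (* a negative kappa is the reflection of the case - kappa *)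
  (kappa < 0 ->
     beta kappa = refl (beta (- kappa)) /\
     (forall z, UH z -> k kappa z = Cconj (k (- kappa) (refl z))) /\
     forall gamma, loewner_trace (lambda (- kappa)) 1 gamma ->
       loewner_trace (lambda kappa) 1 (fun t => refl (gamma t)) /\
       forall t, 0 <= t < 1 ->
         forall z, slit (fun s => refl (gamma s)) t z ->
           g kappa t z = refl (g (- kappa) t (refl z))).
Proof.
  intros kappa Hkappa.
  assert (Ha : admissible kappa) by (unfold admissible; lra).
  assert (Ha' := admissible_opp kappa Ha).
  assert (Hk0 : kappa <> 0) by lra.
  split; [now apply k_conformal|].
  split; [split; [now apply log_spiral_spiral|split; [apply spiral_0|now apply spiral_unbounded]]|].
  split; [exists (tip kappa); now apply tip_loewner_trace|].
  split.
  - intros gamma Htr. assert (Hg := loewner_trace_tip kappa gamma Ha Htr).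
    split; [|split; [|split; [|split; [|split; [|split]]]]].
    + assert (Hsp : forall u, Cexp (- (RtoC u * eith kappa)) = spiral kappa (- u)).
      { intros u. unfold spiral. rewrite RtoC_opp. f_equal. ring. }
      intros z. split.
      * intros [t [Ht <-]]. rewrite Hg by exact Ht.
        destruct (tip_spec kappa t Ha Ht) as [H1 H2]. split; [exact H1|].
        exists (clock kappa t). split; [now apply clock_pos|]. now rewrite Hsp.
      * intros [Hz [u [Hu E]]]. destruct (clock_surjective kappa u Ha Hu) as [t [Ht Et]].
        exists t. split; [exact Ht|]. rewrite Hg by exact Ht. symmetry.
        apply tip_unique; auto. now rewrite Et, <- Hsp.
    + intros t Ht. rewrite Hg by exact Ht. now apply tip_spec.
    + assert (HF : Filter (at_right 0)) by apply within_filter, locally_filter.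
      apply (filterlim_ext_loc (tip kappa)); [|now apply tip_at_right_0].
      generalize at_right_0_unit. apply filter_imp. intros t Ht. symmetry. now apply Hg.
    + now apply UH_beta.
    + now apply tip_spirals.
    + intros t Ht. assert (Hslit := fun z => slit_iff kappa gamma t z Ha Ht Hg).
      split; [|split; [|split]].
      * intros z Hz. now apply Hslit.
      * now apply g_conformal.
      * apply g_hydrodynamic; auto. intros z Hz. now apply Hslit.
      * intros z Hz. apply cdiff_is_derive_on; [exact Ht|].
        apply cdiff_g; auto. now apply Hslit.
    + intros z Hz. now apply g_0.
  - intros _. split; [|split].
    + rewrite beta_opp. now rewrite refl_refl.
    + intros z Hz. rewrite k_refl, Cconj_conj; [reflexivity|exact Ha|].
      apply nonneg_above; [exact Ha|now apply Rlt_le].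
    + intros gamma Htr. assert (Hg := loewner_trace_tip (- kappa) gamma Ha' Htr).
      assert (Hg' : forall s, 0 < s < 1 -> refl (gamma s) = tip kappa s).
      { intros s Hs. rewrite Hg by exact Hs. now apply tip_refl. }
      split; [now apply tip_loewner_trace|].
      intros t Ht z Hz. apply (slit_iff kappa) in Hz; auto.
      now apply g_refl.
Qed.
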